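(* Let $-1<H<1$, let $\Gamma$ be a closed codimension-$1$ submanifold of $S^n_\infty(\mathbb{H}^{n+1})$, and let $\Sigma$ be a complete hypersurface in $\mathbb{H}^{n+1}$ with constant mean curvature $H$ and asymptotic boundary $\partial_\infty\Sigma=\Gamma$. Then $\Sigma$ is contained in the $H$-shifted convex hull of $\Gamma$, i.e. $\Sigma\subset CH_H(\Gamma)$.
   Context: Here $n\ge 2$, $S^n_\infty(\mathbb{H}^{n+1})$ is the sphere at infinity of hyperbolic space $\mathbb{H}^{n+1}$, and $\partial_\infty X$ denotes the asymptotic boundary of $X\subset\mathbb{H}^{n+1}$ in it. Orientation and sign of mean curvature. A closed codimension-$1$ submanifold $\Gamma\subset S^n_\infty(\mathbb{H}^{n+1})$ separates the sphere at infinity into two parts, labelled $\Omega^+_\Gamma$ and $\Omega^-_\Gamma$ (a choice, fixed throughout). A hypersurface $\Sigma\subset\mathbb{H}^{n+1}$ with $\partial_\infty\Sigma=\Gamma$ separates $\mathbb{H}^{n+1}$; its positive (negative) side is the one asymptotic to $\Omega^+_\Gamma$ ($\Omega^-_\Gamma$). The mean curvature (the average of the $n$ principal curvatures) is taken positive if the mean curvature vector points to the positive side and negative if it points to the negative side. Compatible orientation of round spheres. Let $T$ be a round $(n-1)$-sphere in $S^n_\infty(\mathbb{H}^{n+1})$ disjoint from $\Gamma$ with $\Gamma$ contained in one of the two components of the complement of $T$; the other component is then contained in $\Omega^+_\Gamma$ or in $\Omega^-_\Gamma$. The two components are labelled $\Omega^+_T,\Omega^-_T$ as follows: if $T\subset\Omega^+_\Gamma$,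 the component contained in $\Omega^+_\Gamma$ is called $\Omega^+_T$ (and the other $\Omega^-_T$); if $T\subset\Omega^-_\Gamma$, the component contained in $\Omega^-_\Gamma$ is called $\Omega^-_T$ (and the other $\Omega^+_T$). $H$-shifted halfspaces. For $-1<H<1$, let $P_H$ be the unique complete hypersurface of constant mean curvature $H$ in $\mathbb{H}^{n+1}$ asymptotic to the oriented sphere $T$; it is a hypersurface equidistant from the totally geodesic hyperplane $P$ asymptotic to $T$ (with the sign convention that the positive (negative) side of a hypersurface asymptotic to $T$ is the one asymptotic to $\Omega^+_T$ ($\Omega^-_T$), and that its mean curvature is positive if the mean curvature vector points to the positive side and negative if it points to the negative side, $P_H$ lies on the negative side of $P$ if $H>0$, on the positive side if $H<0$, and equals $P$ if $H=0$). $P_H$ divides $\mathbb{H}^{n+1}$ into two domains $D_H^+$ and $D_H^-$ with $\partial_\infty D_H^\pm=\Omega^\pm_T$ (up to the common boundary $T$); these are called $H$-shifted halfspaces. Such a domain is a supporting $H$-shifted halfspace for $\Gamma$ if its asymptotic boundary contains $\Gamma$. The $H$-shifted convex hull $CH_H(\Gamma)$ is the intersection of all supporting closed $H$-shifted halfspaces of $\Gamma$. *)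

(* Defs.v *)
(* Hyperbolic space H^{n+1} is the hyperboloid model: the upper sheet of
   <x, x> = -1 in R^{n+2}, with the Riemannian metric induced by the Lorentzian
   form, coordinate 0 being the time coordinate. *)
From HB Require Import structures.
From mathcomp Require Import all_boot all_order all_algebra.
From mathcomp Require Import all_classical all_reals all_analysis.

Set Implicit Arguments.
Unset Strict Implicit.
Unset Printing Implicit Defensive.

Import Order.TTheory GRing.Theory Num.Theory.
Import numFieldNormedType.Exports.

Local Open Scope classical_set_scope.
Local Open Scope ring_scope.

Section Ambient.
Variable R : realType.

Definition dot (m : nat) (x y : 'rV[R]_m) : R := \sum_(i < m) x 0 i * y 0 i.

Definition time (m : nat) (x : 'rV[R]_m.+1) : R := x 0 ord0.

Definition space (m : nat) (x : 'rV[R]_m.+1) : 'rV[R]_m :=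
  \row_(i < m) x 0 (lift ord0 i).

Definition lorentz (m : nat) (x y : 'rV[R]_m.+1) : R :=
  dot (space x) (space y) - time x * time y.

Definition hyp (n : nat) : set 'rV[R]_n.+2 :=
  [set x | lorentz x x = -1 /\ 0 < time x].

(* The sphere at infinity: xi stands for the endpoint of the null ray spanned
   by (1, xi). *)
Definition sphere_inf (n : nat) : set 'rV[R]_n.+1 := [set xi | dot xi xi = 1].

(* Central projection to the open unit ball (Klein model). The compactification
   of H^{n+1} by its sphere at infinity is the closed unit ball. *)
Definition klein (n : nat) (x : 'rV[R]_n.+2) : 'rV[R]_n.+1 :=
  (time x)^-1 *: space x.

Definition asymp_boundary (n : nat) (X : set 'rV[R]_n.+2) : set 'rV[R]_n.+1 :=
  @sphere_inf n `&` closure (@klein n @` X).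

Definition rel_open (m : nat) (S A : set 'rV[R]_m) : Prop :=
  exists2 W : set 'rV[R]_m, open W & A = S `&` W.

(* The geodesic of H^{n+1} from p with unit initial velocity N. *)
Definition geodesic (n : nat) (p N : 'rV[R]_n.+2) (t : R) : 'rV[R]_n.+2 :=
  ((expR t + expR (- t)) / 2) *: p + ((expR t - expR (- t)) / 2) *: N.

End Ambient.

Section Submanifolds.
Variable R : realType.

Definition partial (d m : nat) (i : 'I_d) (f : 'rV[R]_d -> 'rV[R]_m) :
  'rV[R]_d -> 'rV[R]_m := 'D_(delta_mx 0 i) f.

(* f is of class C^k on U; meant for U open. *)
Fixpoint Ck (d m k : nat) (U : set 'rV[R]_d) (f : 'rV[R]_d -> 'rV[R]_m) : Prop :=
  (forall x, U x -> {for x, continuous f}) /\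
  if k is k'.+1 then
    forall i : 'I_d,
      (forall x, U x -> derivable f x (delta_mx 0 i)) /\ Ck k' U (partial i f)
  else True.

(* f : U -> S is a homeomorphism of class C^k from the open set U of R^d onto a
   relatively open subset of S, with p = f q. *)
Definition local_param (d m k : nat) (S : set 'rV[R]_m) (p : 'rV[R]_m)
    (U : set 'rV[R]_d) (f : 'rV[R]_d -> 'rV[R]_m) (q : 'rV[R]_d) : Prop :=
  [/\ open U, U q, f q = p, Ck k U f &
      {in U &, injective f} /\
      forall V, open V -> V `<=` U -> rel_open S (f @` V)].

Definition immersion (d m : nat) (U : set 'rV[R]_d)
    (f : 'rV[R]_d -> 'rV[R]_m) : Prop :=
  forall x, U x -> row_free (\matrix_(i < d, j < m) partial i f x 0 j).

(* Closed (compact, without boundary) codimension-1 submanifold of the sphere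
   at infinity; no differentiability is required. *)
Definition closed_codim1_submanifold (n : nat) (G : set 'rV[R]_n.+1) : Prop :=
  [/\ G `<=` @sphere_inf R n, compact G &
      forall p, G p -> exists (U : set 'rV[R]_n.-1)
        (f : 'rV[R]_n.-1 -> 'rV[R]_n.+1) (q : 'rV[R]_n.-1),
        local_param 0 G p U f q].

Definition hypersurface (n : nat) (S : set 'rV[R]_n.+2) : Prop :=
  S `<=` @hyp R n /\
  forall p, S p -> exists (U : set 'rV[R]_n)
    (f : 'rV[R]_n -> 'rV[R]_n.+2) (q : 'rV[R]_n),
    local_param 2 S p U f q /\ immersion U f.

(* The induced Riemannian distance of S between x and y is smaller than e:
   some C^1 curve in S joining x to y has length smaller than e. *)
Definition intrinsic_dist_lt (n : nat) (S : set 'rV[R]_n.+2)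
    (x y : 'rV[R]_n.+2) (e : R) : Prop :=
  exists c : R -> 'rV[R]_n.+2,
    [/\ (forall t, derivable c t 1) /\ continuous (c^`())%classic,
        forall t, 0 <= t <= 1 -> S (c t),
        c 0 = x, c 1 = y &
        (\int[lebesgue_measure]_(t in `[0%R, 1%R])
           (Num.sqrt (lorentz (c^`()%classic t) (c^`()%classic t)))%:E < e%:E)%E].

Definition complete_hypersurface (n : nat) (S : set 'rV[R]_n.+2) : Prop :=
  hypersurface S /\
  forall u : nat -> 'rV[R]_n.+2, (forall i, S (u i)) ->
    (forall e : R, 0 < e -> exists N : nat, forall i j : nat,
       (N <= i)%N -> (N <= j)%N -> intrinsic_dist_lt S (u i) (u j) e) ->
    exists2 p, S p & forall e : R, 0 < e -> exists N : nat, forall i : nat,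
       (N <= i)%N -> intrinsic_dist_lt S (u i) p e.

End Submanifolds.

Section MeanCurvature.
Variable R : realType.

Definition first_form (n : nat) (f : 'rV[R]_n -> 'rV[R]_n.+2) (q : 'rV[R]_n) :
  'M[R]_n := \matrix_(i < n, j < n) lorentz (partial i f q) (partial j f q).

(* Since N is tangent to the hyperboloid, pairing the second derivatives taken
   in the flat ambient R^{n+2} with N gives the second fundamental form of the
   hypersurface inside H^{n+1}. *)
Definition second_form (n : nat) (f : 'rV[R]_n -> 'rV[R]_n.+2) (q : 'rV[R]_n)
    (N : 'rV[R]_n.+2) : 'M[R]_n :=
  \matrix_(i < n, j < n) lorentz (partial i (partial j f) q) N.

Definition shape_operator (n : nat) (f : 'rV[R]_n -> 'rV[R]_n.+2)
    (q : 'rV[R]_n) (N : 'rV[R]_n.+2) : 'M[R]_n :=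
  invmx (first_form f q) *m second_form f q N.

(* The eigenvalues of the shape operator, with multiplicity. *)
Definition principal_curvatures (n : nat) (f : 'rV[R]_n -> 'rV[R]_n.+2)
    (q : 'rV[R]_n) (N : 'rV[R]_n.+2) (k : 'I_n -> R) : Prop :=
  char_poly (shape_operator f q N) = \prod_(i < n) ('X - (k i)%:P).

(* N is a unit vector of T_p H^{n+1} normal to the hypersurface f(U) at
   p = f q. *)
Definition unit_normal (n : nat) (f : 'rV[R]_n -> 'rV[R]_n.+2) (q : 'rV[R]_n)
    (N : 'rV[R]_n.+2) : Prop :=
  [/\ lorentz N N = 1, lorentz N (f q) = 0 &
      forall i : 'I_n, lorentz N (partial i f q) = 0].

Definition points_from_to (n : nat) (Dm Dp : set 'rV[R]_n.+2)
    (p N : 'rV[R]_n.+2) : Prop :=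
  \forall t \near (0 : R)^'+,
    Dp (geodesic p N t) /\ Dm (geodesic p N (- t)).

(* The mean curvature vector is h times the unit normal pointing to Dp, so that
   h is positive exactly when this vector points to Dp. *)
Definition mean_curvature_at (n : nat) (S Dp Dm : set 'rV[R]_n.+2)
    (p : 'rV[R]_n.+2) (h : R) : Prop :=
  exists (U : set 'rV[R]_n) (f : 'rV[R]_n -> 'rV[R]_n.+2) (q : 'rV[R]_n)
         (N : 'rV[R]_n.+2) (k : 'I_n -> R),
    [/\ local_param 2 S p U f q /\ immersion U f,
        unit_normal f q N,
        points_from_to Dm Dp p N,
        principal_curvatures f q N k &
        h = (\sum_(i < n) k i) / n%:R].

End MeanCurvature.

Section ShiftedHull.
Variable R : realType.

(* G separates the sphere at infinity into the two parts Op and Om. They need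
   not be connected, as G need not be. *)
Definition separates_sphere (n : nat) (G Op Om : set 'rV[R]_n.+1) : Prop :=
  [/\ rel_open (@sphere_inf R n) Op, rel_open (@sphere_inf R n) Om,
      Op !=set0 /\ Om !=set0, Op `&` Om = set0 &
      Op `|` Om = @sphere_inf R n `\` G].

(* Dp and Dm are the positive and negative sides of S, S being asymptotic to G.
   The two last clauses determine the asymptotic boundaries of Dp and Dm up to
   points of G. *)
Definition sides (n : nat) (G Op Om : set 'rV[R]_n.+1)
    (S Dp Dm : set 'rV[R]_n.+2) : Prop :=
  [/\ rel_open (@hyp R n) Dp /\ rel_open (@hyp R n) Dm,
      Dp `&` Dm = set0,
      Dp `|` Dm = @hyp R n `\` S,
      Op `<=` asymp_boundary Dp /\ asymp_boundary Dp `<=` Op `|` G &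
      Om `<=` asymp_boundary Dm /\ asymp_boundary Dm `<=` Om `|` G].

Definition complete_cmc_hypersurface (n : nat) (H : R)
    (G Op Om : set 'rV[R]_n.+1) (S Dp Dm : set 'rV[R]_n.+2) : Prop :=
  [/\ complete_hypersurface S, asymp_boundary S = G, sides G Op Om S Dp Dm &
      forall p, S p -> mean_curvature_at S Dp Dm p H].

(* The round (n-1)-spheres of the sphere at infinity are its sections by
   hyperplanes dot xi a = c with dot a a = 1 and -1 < c < 1; the components of
   the complement are cap a c and cap (- a) (- c). *)
Definition round_sphere (n : nat) (a : 'rV[R]_n.+1) (c : R) : set 'rV[R]_n.+1 :=
  [set xi | sphere_inf xi /\ dot xi a = c].

Definition cap (n : nat) (a : 'rV[R]_n.+1) (c : R) : set 'rV[R]_n.+1 :=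
  [set xi | sphere_inf xi /\ c < dot xi a].

(* T is disjoint from G, which lies in one of the components Tp, Tm of the
   complement of T, and the labels of Tp (positive) and Tm (negative) are
   compatible with those of Op and Om. *)
Definition compatible_orientation (n : nat) (G Op Om T Tp Tm : set 'rV[R]_n.+1) :
    Prop :=
  [/\ T `<=` Op, Tp `<=` Op & G `<=` Tm] \/
  [/\ T `<=` Om, Tm `<=` Om & G `<=` Tp].

(* D is an open H-shifted halfspace supporting G: one of the sides of P_H, the
   complete hypersurface of constant mean curvature H asymptotic to the
   oriented round sphere T. Both orientations of T occur, because (a, c) and
   (- a, - c) give the same sphere with the labels of the components
   exchanged. *)
Definition supporting_shifted_halfspace (n : nat) (H : R)
    (G Op Om : set 'rV[R]_n.+1) (D : set 'rV[R]_n.+2) : Prop :=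
  exists (a : 'rV[R]_n.+1) (c : R) (PH Dp Dm : set 'rV[R]_n.+2),
    let T := round_sphere a c in
    let Tp := cap a c in
    let Tm := cap (- a) (- c) in
    [/\ dot a a = 1 /\ -1 < c < 1,
        compatible_orientation G Op Om T Tp Tm,
        complete_cmc_hypersurface H T Tp Tm PH Dp Dm,
        D = Dp \/ D = Dm &
        G `<=` asymp_boundary D].

Definition shifted_convex_hull (n : nat) (H : R) (G Op Om : set 'rV[R]_n.+1) :
    set 'rV[R]_n.+2 :=
  [set x | hyp x /\
    forall D, supporting_shifted_halfspace H G Op Om D -> closure D x].

End ShiftedHull.

(* Main.v *)
From HB Require Import structures.
From mathcomp Require Import all_boot all_order all_algebra.
From mathcomp Require Import all_classical all_reals all_analysis.
From mathcomp Require Import ring lra.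
Require Import Defs.

Import Order.TTheory GRing.Theory Num.Theory.
Import numFieldNormedType.Exports.
Local Open Scope classical_set_scope.
Local Open Scope ring_scope.

Set Implicit Arguments.
Unset Strict Implicit.
Unset Printing Implicit Defensive.

(** The height of a point above a totally geodesic hyperplane with unit normal
    [nu] (a spacelike vector) is the linear function [lorentz x nu]; it is the
    hyperbolic sine of the signed distance.  Its level sets are the equidistant
    hypersurfaces, the level [s] having mean curvature [- s / sqrt (1 + s^2)]
    with respect to the upward normal, so curvature [H] is attained exactly at
    [critical_height H].  The proof compares a hypersurface with these level
    sets at a highest point, through the second derivatives there.

    Let [S] have constant mean curvature [H], let its boundary at infinity avoid
    the closed cap cut out by the hyperplane, and let that cap lie in the
    positive part of the sphere at infinity.  The height tends to minus infinity
    at the boundary of [S], so it is maximal at some [p] in [S] ([max_height]).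
    The region strictly above [p] is connected and reaches the cap, hence it
    lies on the positive side of [S] ([region_in_side]); in particular the unit
    normal at [p] pointing to the positive side points upwards.  With [s] the
    height of [p], [g] the first and [II] the second fundamental form, the
    Hessian of the height in a parametrisation is [s g + sqrt (1 + s^2) II].
    It is nonpositive at a maximum, and its trace with respect to [g] gives
    [s + H sqrt (1 + s^2) <= 0] ([touching_height]), that is
    [s <= critical_height H] ([cmc_barrier]).

    For the hypersurface of the theorem this bounds the height from above.
    A hypersurface [P_H] asymptotic to the round sphere itself is bounded from
    below by the same argument with reversed orientation, applied to slightly
    smaller caps, which its boundary does avoid, followed by a passage to the
    limit ([round_sphere_barrier]).  So everything strictly below the critical
    height is on the negative side of [P_H], and the closure of that side
    contains all points of height at most critical ([half_space_barrier]).  The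
    other orientation of the round sphere follows by exchanging the two sides
    and changing the sign of [H]. *)

(** * Lorentzian linear algebra *)

Section Lorentz.
Variables (R : realType) (m : nat).

Lemma dotC (d : nat) (x y : 'rV[R]_d) : dot x y = dot y x.
Proof. by rewrite /dot; apply: eq_bigr => i _; rewrite mulrC. Qed.

Lemma dot_lin (d : nat) (k : R) (x y z : 'rV[R]_d) :
  dot (k *: x + y) z = k * dot x z + dot y z.
Proof.
rewrite /dot mulr_sumr -big_split /=; apply: eq_bigr => i _.
by rewrite !mxE mulrDl mulrA.
Qed.

Lemma dot0l (d : nat) (x : 'rV[R]_d) : dot 0 x = 0.
Proof. by rewrite /dot big1 // => i _; rewrite mxE mul0r. Qed.

Lemma dotZl (d : nat) (k : R) (x z : 'rV[R]_d) : dot (k *: x) z = k * dot x z.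
Proof. by rewrite -[k *: x]addr0 dot_lin dot0l addr0. Qed.

Lemma dotDl (d : nat) (x y z : 'rV[R]_d) : dot (x + y) z = dot x z + dot y z.
Proof. by rewrite -[x]scale1r dot_lin mul1r scale1r. Qed.

Lemma dotDr (d : nat) (x y z : 'rV[R]_d) : dot z (x + y) = dot z x + dot z y.
Proof. by rewrite dotC dotDl !(dotC z). Qed.

Lemma dotZr (d : nat) (k : R) (x z : 'rV[R]_d) : dot x (k *: z) = k * dot x z.
Proof. by rewrite dotC dotZl dotC. Qed.

Lemma dotNr (d : nat) (x z : 'rV[R]_d) : dot x (- z) = - dot x z.
Proof. by rewrite -scaleN1r dotZr mulN1r. Qed.

Lemma dot_ge0 (d : nat) (x : 'rV[R]_d) : 0 <= dot x x.
Proof. by apply: sumr_ge0 => i _; rewrite -expr2 sqr_ge0. Qed.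

Lemma dot_eq0 (d : nat) (x : 'rV[R]_d) : dot x x = 0 -> x = 0.
Proof.
rewrite /dot => /eqP; rewrite psumr_eq0; last by move=> i _; rewrite -expr2 sqr_ge0.
move=> /allP h; apply/rowP => i; rewrite mxE.
have := h i (mem_index_enum _); rewrite /= mulf_eq0 orbb.
by move/eqP.
Qed.

Lemma dot_gt0 (d : nat) (x : 'rV[R]_d) : x != 0 -> 0 < dot x x.
Proof.
move=> x0; rewrite lt_neqAle dot_ge0 andbT eq_sym.
by apply: contra x0 => /eqP/dot_eq0 ->.
Qed.

(** Cauchy--Schwarz: expand the square of [dot y y *: x - dot x y *: y]. *)
Lemma dot_cauchy (d : nat) (x y : 'rV[R]_d) :
  dot x y ^+ 2 <= dot x x * dot y y.
Proof.
have [-> | y0] := eqVneq y 0; first by rewrite dotC !dot0l mulr0 expr2 mul0r.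
have := dot_ge0 (dot y y *: x + (- dot x y) *: y).
rewrite !(dotDl, dotDr, dotZl, dotZr) (dotC y x).
have := dot_gt0 y0; move: (dot x y) (dot y y) (dot x x) => b c a c0 h.
have {}h : 0 <= c * (a * c - b ^+ 2) by move: h; congr (_ <= _); ring.
by move: h; rewrite pmulr_rge0 // subr_ge0.
Qed.

Implicit Types x y z p w : 'rV[R]_m.+1.

Lemma lorentzC x y : lorentz x y = lorentz y x.
Proof. by rewrite /lorentz dotC mulrC. Qed.

Lemma time_lin (k : R) x y : time (k *: x + y) = k * time x + time y.
Proof. by rewrite /time !mxE. Qed.

Lemma space_lin (k : R) x y : space (k *: x + y) = k *: space x + space y.
Proof. by apply/rowP => i; rewrite !mxE. Qed.

Lemma lorentz_lin (k : R) x y z :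
  lorentz (k *: x + y) z = k * lorentz x z + lorentz y z.
Proof. rewrite /lorentz time_lin space_lin dot_lin; ring. Qed.

Lemma lorentz0l z : lorentz 0 z = 0.
Proof.
have := lorentz_lin 1 0 0 z; rewrite scaler0 addr0 mul1r => h.
by apply: (addrI (lorentz 0 z)); rewrite -h addr0.
Qed.

Lemma lorentzZl (k : R) x z : lorentz (k *: x) z = k * lorentz x z.
Proof. by rewrite -[k *: x]addr0 lorentz_lin lorentz0l addr0. Qed.

Lemma lorentzDl x y z : lorentz (x + y) z = lorentz x z + lorentz y z.
Proof. by rewrite -[x]scale1r lorentz_lin mul1r scale1r. Qed.

Lemma lorentzNl x z : lorentz (- x) z = - lorentz x z.
Proof. by rewrite -scaleN1r lorentzZl mulN1r. Qed.

Lemma lorentzDr x y z : lorentz z (x + y) = lorentz z x + lorentz z y.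
Proof. by rewrite lorentzC lorentzDl !(lorentzC z). Qed.

Lemma lorentzZr (k : R) x z : lorentz x (k *: z) = k * lorentz x z.
Proof. by rewrite lorentzC lorentzZl lorentzC. Qed.

Lemma lorentzNr x z : lorentz x (- z) = - lorentz x z.
Proof. by rewrite lorentzC lorentzNl lorentzC. Qed.

Definition lorentzE := (lorentzDl, lorentzDr, lorentzZl, lorentzZr,
  lorentzNl, lorentzNr).

Lemma lorentz_suml (I : finType) (F : I -> 'rV[R]_m.+1) z :
  lorentz (\sum_i F i) z = \sum_i lorentz (F i) z.
Proof.
by rewrite (big_morph (fun x => lorentz x z) (fun x y => lorentzDl x y z)
  (lorentz0l z)).
Qed.

Lemma eq_time_space x y : time x = time y -> space x = space y -> x = y.
Proof.
move=> txy sxy; apply/rowP => i; have [j ->|->] := unliftP ord0 i => //.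
by have /rowP/(_ j) := sxy; rewrite !mxE.
Qed.

Lemma timelike_time x : lorentz x x < 0 -> time x != 0.
Proof.
apply: contraTneq => t0; rewrite /lorentz t0 mul0r subr0 -leNgt.
exact: dot_ge0.
Qed.

(** The orthogonal complement of a timelike vector is positive definite; this
    makes the induced metric of a hypersurface of hyperbolic space Riemannian. *)
Lemma orth_timelike p w :
  lorentz p p < 0 -> lorentz p w = 0 -> w != 0 -> 0 < lorentz w w.
Proof.
move=> pp pw w0; have tp0 := timelike_time pp.
have tp2 : 0 < time p ^+ 2 by rewrite lt_neqAle sqr_ge0 andbT eq_sym sqrf_eq0.
move: pp pw; rewrite /lorentz -!expr2 subr_lt0 => pp /eqP.
rewrite subr_eq0 => /eqP pw.
have CS := dot_cauchy (space p) (space w); rewrite pw exprMn in CS.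
have [sw0 | sw0] := eqVneq (space w) 0.
  move: pw; rewrite sw0 dotC dot0l => /esym/eqP; rewrite mulf_eq0 (negPf tp0).
  move=> /eqP tw0; case/eqP: w0; apply: eq_time_space.
    by rewrite tw0 /time mxE.
  by rewrite sw0; apply/rowP => i; rewrite !mxE.
rewrite subr_gt0 -(ltr_pM2l tp2); apply: (le_lt_trans CS).
by rewrite ltr_pM2r // dot_gt0.
Qed.

(** Cauchy--Schwarz for the space parts, which are shorter than the time coordinates. *)
Lemma future_lorentz x y : lorentz x x < 0 -> lorentz y y < 0 ->
  0 < time x -> 0 < time y -> lorentz x y < 0.
Proof.
rewrite /lorentz -!expr2 !subr_lt0 => xx yy tx ty.
have txy : 0 < time x * time y by rewrite mulr_gt0.
have [d0|d0] := leP (dot (space x) (space y)) 0; first exact: le_lt_trans txy.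
rewrite -(@ltr_pXn2r _ 2) ?nnegrE ?ltW //.
apply: (le_lt_trans (dot_cauchy _ _)); rewrite exprMn.
by apply: ltr_pM => //; exact: dot_ge0.
Qed.

(** Membership in the upper sheet is later checked through a pairing with a known
    future-directed vector instead of through the time coordinate. *)
Lemma future_of_lorentz_lt0 w z : lorentz w w < 0 -> lorentz z z < 0 ->
  0 < time z -> lorentz w z < 0 -> 0 < time w.
Proof.
move=> ww zz tz wz; rewrite ltNge le_eqVlt (negPf (timelike_time ww)) /=.
apply/negP => tw.
have := @future_lorentz (- w) z; rewrite !lorentzE opprK => /(_ ww zz).
have -> : time (- w) = - time w by rewrite /time mxE.
by rewrite oppr_gt0 => /(_ tw tz); rewrite oppr_lt0 ltNge ltW.
Qed.

Lemma hyp_timelike n (x : 'rV[R]_n.+2) : hyp x -> lorentz x x < 0.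
Proof. by case=> -> _; rewrite ltrN10. Qed.

End Lorentz.

(** * Traces against a positive definite form *)

Section PositiveForms.
Variable R : realType.

Definition quad_form (n : nat) (B : 'M[R]_n) (v : 'rV[R]_n) : R :=
  (v *m B *m v^T) 0 0.

(** Gram--Schmidt in matrix form, by induction on the size: clearing the first row
    and column leaves the Schur complement, which is again positive definite
    because its values are values of the original form on vectors whose first
    coordinate is chosen optimally. *)
Lemma posdef_congruent_id (n : nat) (g : 'M[R]_n) :
  g^T = g -> (forall v, v != 0 -> 0 < quad_form g v) ->
  exists P : 'M[R]_n, P *m g *m P^T = 1%:M.
Proof.
elim: n g => [|n IHn]; first by move=> g _ _; exists 0; apply/matrixP => -[].
rewrite -[n.+1]/(1 + n)%N => g gT gpos.
have Eg : g = block_mx (ulsubmx g) (ursubmx g) (ursubmx g)^T (drsubmx g).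
  by rewrite trmx_ursub gT submxK.
have drT : (drsubmx g)^T = drsubmx g by rewrite trmx_drsub gT.
move: (ulsubmx g) (ursubmx g) (drsubmx g) Eg drT => al b G Eg GT.
have [a Ea] : exists a : R, al = a%:M.
  by exists (al 0 0); apply/matrixP => i j; rewrite !ord1 !mxE eqxx mulr1n.
rewrite Ea in Eg.
have bT (v : 'rV_n) : b *m v^T = ((v *m b^T) 0 0)%:M.
  rewrite -[LHS]trmxK trmx_mul trmxK; apply/matrixP => i j.
  by rewrite !ord1 mxE !mxE eqxx mulr1n.
have vb (v : 'rV_n) : v *m b^T = ((v *m b^T) 0 0)%:M.
  by apply/matrixP => i j; rewrite !ord1 [RHS]mxE eqxx mulr1n.
have qf (x : R) (v : 'rV_n) : quad_form g (row_mx x%:M v) =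
    a * x ^+ 2 + 2 * x * (v *m b^T) 0 0 + quad_form G v.
  rewrite /quad_form Eg mul_row_block tr_row_mx mul_row_col !mulmxDl.
  rewrite -(mulmxA _ b) bT vb -!scalar_mxM tr_scalar_mx -!scalar_mxM.
  by rewrite !mxE !eqxx !mulr1n; ring.
have a0 : 0 < a.
  have := gpos (row_mx 1%:M 0); rewrite qf /quad_form !mul0mx !mxE.
  rewrite mulr0 !addr0 expr1n mulr1; apply.
  apply/eqP => /rowP/(_ (lshift n 0)).
  by rewrite row_mxEl !mxE /= => /eqP; rewrite oner_eq0.
pose G' := G - a^-1 *: (b^T *m b).
have qG' v : quad_form G' v = quad_form G v - a^-1 * ((v *m b^T) 0 0) ^+ 2.
  rewrite /quad_form /G' mulmxBr mulmxBl -scalemxAr -scalemxAl.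
  rewrite mulmxA -(mulmxA _ b) bT {1}vb -scalar_mxM.
  by rewrite !mxE eqxx mulr1n.
have [||P' HP'] := IHn G'.
- by rewrite /G' linearB linearZ /= trmx_mul trmxK GT.
- move=> v v0; rewrite qG'.
  have := gpos (row_mx (- a^-1 * (v *m b^T) 0 0)%:M v); rewrite qf.
  have -> : row_mx (- a^-1 * (v *m b^T) 0 0)%:M v != 0.
    by apply: contra v0; rewrite -row_mx0 => /eqP/eq_row_mx[_ ->].
  move=> /(_ isT); congr (0 < _); field.
  by rewrite gt_eqF.
(* normalise the first vector and subtract its component from the others *)
pose s := Num.sqrt a.
have s0 : s != 0 by rewrite gt_eqF // sqrtr_gt0.
have ss : a = s ^+ 2 by rewrite sqr_sqrtr // ltW.
exists (block_mx (s^-1)%:M 0 (- a^-1 *: (P' *m b^T)) P').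
rewrite Eg tr_block_mx !mulmx_block scalar_mx_block.
rewrite !(mul0mx, trmx0, mulmx0, addr0, add0r, tr_scalar_mx).
have aP : - a^-1 *: (P' *m b^T) *m a%:M = - (P' *m b^T).
  by rewrite mul_mx_scalar scalerA mulrN divff ?gt_eqF // scaleN1r.
have aP' : (- a^-1 *: (P' *m b^T))^T = - a^-1 *: (b *m P'^T).
  by rewrite linearZ /= trmx_mul trmxK.
rewrite aP addNr !mul0mx add0r aP' -!scalar_mxM; congr block_mx.
- by rewrite ss; congr (_%:M); field.
- rewrite !mul_scalar_mx -scalemxAl scalerA mulrN mulfK ?gt_eqF //.
  by rewrite scaleNr addNr.
- rewrite -HP' /G' mulmxBr mulmxBl mulmxDl addrC; congr (_ + _).
  by rewrite -scalemxAr -!scalemxAl scaleNr !mulmxA.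
Qed.

Lemma posdef_unitmx (n : nat) (g : 'M[R]_n) :
  g^T = g -> (forall v, v != 0 -> 0 < quad_form g v) -> g \in unitmx.
Proof.
move=> gT gpos; have [P] := posdef_congruent_id gT gpos.
rewrite -mulmxA => /mulmx1_unit[_]; by rewrite unitmx_mul => /andP[].
Qed.

(** If [P g P^T = 1] then [g^-1 = P^T P], and cyclicity of the trace turns the left
    side into the sum of the values of [B] on the rows of [P]. *)
Lemma trace_posdef_ge0 (n : nat) (g B : 'M[R]_n) :
  g^T = g -> (forall v, v != 0 -> 0 < quad_form g v) ->
  (forall v, 0 <= quad_form B v) -> 0 <= \tr (invmx g *m B).
Proof.
move=> gT gpos B0; have [P HP] := posdef_congruent_id gT gpos.
have gu := posdef_unitmx gT gpos.
have -> : invmx g = P^T *m P.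
  have /mulmx1C : P *m (g *m P^T) = 1%:M by rewrite mulmxA.
  by rewrite -mulmxA -{2}[P^T *m P](mulKmx gu) => ->; rewrite mulmx1.
rewrite -mulmxA mxtrace_mulC; apply: sumr_ge0 => i _.
have -> : (P *m B *m P^T) i i = quad_form B (row i P).
  rewrite /quad_form -row_mul [LHS]mxE [RHS]mxE; apply: eq_bigr => k _.
  by congr (_ * _); rewrite ?mxE.
exact: B0.
Qed.

End PositiveForms.

(** * Directional derivatives and maxima *)

Section Calculus.
Variable R : realType.

Lemma is_derive_line (V : normedModType R) (h : V -> R) (y e : V) (s d : R) :
  is_derive (y + s *: e) e h d -> is_derive s 1 (fun s => h (y + s *: e)) d.
Proof.
move=> [hd hD].
have E : (fun k : R => k^-1 *: (((fun s => h (y + s *: e)) \o shift s) (k *: 1) -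
      h (y + s *: e))) =
    (fun k : R => k^-1 *: ((h \o shift (y + s *: e)) (k *: e) - h (y + s *: e))).
  apply/funext => k /=; congr (_ *: (h _ - _)).
  by rewrite [k%:A]mulr1 scalerDl addrCA.
by split; rewrite /derivable /derive E.
Qed.

Lemma mean_value_line (V : normedModType R) (h : V -> R) (y e : V) (s : R) :
  (forall u : R, `|u| <= `|s| -> derivable h (y + u *: e) e) ->
  exists2 u, `|u| <= `|s| & h (y + s *: e) - h y = s * 'D_e h (y + u *: e).
Proof.
move=> hd.
have dh (u : R) : `|u| <= `|s| ->
    is_derive u 1 (fun u => h (y + u *: e)) ('D_e h (y + u *: e)).
  by move=> us; apply: is_derive_line; apply: derivableP; exact: hd.
have hc (i : interval R) : (forall u : R, u \in i -> `|u| <= `|s|) ->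
    {within [set` i], continuous (fun u => h (y + u *: e))}.
  move=> si; apply: derivable_within_continuous => u /si us.
  by case: (dh u us).
have [s0|s0] := leP 0 s.
  have in_s (u : R) : u \in `[0, s]%R -> `|u| <= `|s|.
    by rewrite in_itv /= => /andP[u0 us]; rewrite !ger0_norm.
  have [|u us E] := @MVT_segment R (fun u => h (y + u *: e))
    (fun u => 'D_e h (y + u *: e)) 0 s s0 _ (hc _ in_s).
    by move=> u /subset_itv_oo_cc us; apply: dh; exact: in_s.
  exists u; first exact: in_s.
  by move: E; rewrite scale0r addr0 subr0 mulrC.
have in_s (u : R) : u \in `[s, 0]%R -> `|u| <= `|s|.
  by rewrite in_itv /= => /andP[u0 us]; rewrite !ler0_norm ?lerN2 // ltW.
have [|u us E] := @MVT_segment R (fun u => h (y + u *: e))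
    (fun u => 'D_e h (y + u *: e)) s 0 (ltW s0) _ (hc _ in_s).
  by move=> u /subset_itv_oo_cc us; apply: dh; exact: in_s.
exists u; first exact: in_s.
move: E; rewrite scale0r addr0 sub0r => /(congr1 -%R).
by rewrite opprB mulrN opprK mulrC.
Qed.

(** Continuity of one partial derivative makes directional derivatives additive in
    that direction: first move along [v], then along [e], and apply the mean value
    theorem to the second step. *)
Lemma is_derive_dirD (V : normedModType R) (h dh : V -> R) (x v e : V)
    (a d : R) :
  is_derive x v h d -> (\forall y \near x, is_derive y e h (dh y)) ->
  {for x, continuous dh} ->
  is_derive x (a *: e + v) h (a * dh x + d).
Proof.
move=> [hv Dv] he ce.
suff H : (fun t : R => t^-1 *: ((h \o shift x) (t *: (a *: e + v)) - h x)) @ 0^'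
    --> a * dh x + d.
  split; first by apply/cvg_ex; eexists; exact: H.
  exact: cvg_lim H.
have -> : (fun t : R => t^-1 *: ((h \o shift x) (t *: (a *: e + v)) - h x)) =
    (fun t : R => t^-1 * (h ((t *: v + x) + (t * a) *: e) - h (t *: v + x)))
    \+ (fun t : R => t^-1 *: ((h \o shift x) (t *: v) - h x)).
  apply/funext => t /=; rewrite -scalerDr; congr (_ *: _).
  rewrite addrA subrK scalerDr scalerA; congr (h _ - _).
  by rewrite -addrA addrC.
apply: cvgD; last by rewrite -Dv; exact: hv.
apply/cvgrPdist_le => eps eps0.
(* the extra 1 covers a = 0 *)
have a1 : 0 < `|a| + 1 by rewrite ltr_wpDl.
have : \forall y \near x, is_derive y e h (dh y) /\
    `|dh x - dh y| <= eps / (`|a| + 1).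
  near=> y; split; first by near: y.
  near: y; move/cvgrPdist_le : ce; apply.
  by rewrite divr_gt0.
move=> /nbhs_normP[dl /= dl0 Hdl].
(* all intermediate points for parameter t are within |t| * M of x *)
pose M := `|v| + `|a| * `|e| + 1.
have M0 : 0 < M by rewrite ltr_wpDl // addr_ge0 // mulr_ge0.
near=> t.
have t0 : t != 0 by near: t; exact: nbhs_dnbhs_neq.
have tM : `|t| < dl / M.
  by near: t; apply: dnbhs0_lt; rewrite divr_gt0.
have near_x (u : R) : `|u| <= `|t * a| ->
    is_derive (t *: v + x + u *: e) e h (dh (t *: v + x + u *: e)) /\
    `|dh x - dh (t *: v + x + u *: e)| <= eps / (`|a| + 1).
  move=> us; apply: Hdl => /=.
  rewrite addrAC opprD addrCA subrr addr0 normrN.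
  apply: (le_lt_trans (ler_normD _ _)); rewrite !normrZ.
  apply: (@le_lt_trans _ _ (`|t| * M)); last by rewrite -ltr_pdivlMr.
  rewrite /M !mulrDr mulr1 mulrA -normrM -addrA lerD2l.
  by rewrite -[leLHS]addr0 lerD // ler_wpM2r.
have [|u us ->] := @mean_value_line V h (t *: v + x) e (t * a).
  by move=> u /near_x[[]].
have [[_ ->] H] := near_x _ us.
rewrite !mulrA mulVf // mul1r -mulrBr normrM.
apply: le_trans (ler_wpM2l (normr_ge0 _) H) _.
rewrite mulrCA ler_piMr ?ltW // ltr_pdivrMr // mul1r.
by rewrite ltrDl.
Unshelve. all: by end_near.
Qed.

(** Iterating [is_derive_dirD] over a family of directions gives the chain rule along
    lines for a function with continuous partial derivatives. *)
Lemma is_derive_dir_sum (V : normedModType R) (I : eqType) (r : seq I)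
    (c : I -> R) (e : I -> V) (h : V -> R) (dh : I -> V -> R) (x : V) :
  (forall i, \forall y \near x, is_derive y (e i) h (dh i y)) ->
  (forall i, {for x, continuous (dh i)}) ->
  is_derive x (\sum_(i <- r) c i *: e i) h (\sum_(i <- r) c i * dh i x).
Proof.
move=> hd hc; elim: r => [|i r IHr].
  by rewrite !big_nil; exact: is_derive0.
by rewrite !big_cons; exact: is_derive_dirD.
Qed.

(** The derivative is given as a function near the point because it is
    differentiated once more in [second_derivative_max_real]. *)
Lemma derive_at_max_real (phi dphi : R -> R) :
  (\forall t \near (0 : R), phi t <= phi 0) ->
  (\forall t \near (0 : R), is_derive (t : R) 1 phi (dphi t)) ->
  dphi 0 = 0.
Proof.
move=> hmax hd.
have /nbhs_ballP[r /= r0 Hr] :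
    \forall t \near (0 : R), phi t <= phi 0 /\ is_derive (t : R) 1 phi (dphi t).
  by near=> t; split; near: t.
have {}Hr (t : R) : t \in `](- r), r[%R ->
    phi t <= phi 0 /\ is_derive (t : R) 1 phi (dphi t).
  rewrite in_itv /= -ltr_norml => tr; apply: Hr.
  by rewrite /ball /= sub0r normrN.
have in0 : (0 : R) \in `](- r), r[%R by rewrite in_itv /= oppr_lt0 r0.
have [_ [_ <-]] := Hr 0 in0.
have hle : - r <= r by rewrite ge0_cp // ltW.
have hder (t : R) : t \in `](- r), r[%R -> derivable phi t 1.
  by move=> /Hr[_ []].
have hphi (t : R) : t \in `](- r), r[%R -> phi t <= phi 0 by move=> /Hr[].
by have [_ ->] := derive1_at_max hle hder in0 hphi.
Unshelve. all: by end_near. Qed.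

(** A positive second derivative makes the first one positive just to the right of
    the critical point, so the function would increase there. *)
Lemma second_derivative_max_real (phi dphi : R -> R) (c : R) :
  (\forall t \near (0 : R), phi t <= phi 0) ->
  (\forall t \near (0 : R), is_derive (t : R) 1 phi (dphi t)) ->
  is_derive (0 : R) 1 dphi c -> c <= 0.
Proof.
move=> hmax hd [hd2 Dc]; rewrite leNgt; apply/negP => c0.
have dphi0 := derive_at_max_real hmax hd.
have /nbhs_ballP[r /= r0 Hr] :
    \forall t \near (0 : R), phi t <= phi 0 /\ is_derive (t : R) 1 phi (dphi t).
  by near=> t; split; near: t.
have {}Hr (t : R) : t \in `](- r), r[%R ->
    phi t <= phi 0 /\ is_derive (t : R) 1 phi (dphi t).
  rewrite in_itv /= -ltr_norml => tr; apply: Hr.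
  by rewrite /ball /= sub0r normrN.
have : \forall t \near (0 : R)^', 0 < t^-1 *: ((dphi \o shift 0) (t *: 1) - dphi 0).
  have := hd2; rewrite /derivable => /cvg_toP; move=> /(_ _ Dc) H.
  by move/cvgr_gt : H; apply.
rewrite dphi0 => H.
have {H} /nbhs_ballP[s /= s0 Hs] := H.
pose t := Num.min r s / 2.
have t0 : 0 < t by rewrite divr_gt0 // lt_min r0 s0.
have trs : t < r /\ t < s.
  have m0 : 0 < Num.min r s by rewrite lt_min r0 s0.
  have tm : t < Num.min r s by rewrite /t; lra.
  by split; apply: (lt_le_trans tm); rewrite ge_min lexx ?orbT.
have itr (u : R) : u \in `[0, t]%R -> u \in `](- r), r[%R.
  rewrite !in_itv /= => /andP[u0 ut]; rewrite (lt_le_trans _ u0) ?oppr_lt0 //=.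
  by apply: le_lt_trans ut _; case: trs.
have [||u ut E] := @MVT R phi dphi 0 t t0.
- by move=> u /subset_itv_oo_cc/itr/Hr[].
- apply: derivable_within_continuous => u /itr/Hr[_ []] //.
have u0 : 0 < u by move: ut; rewrite in_itv /= => /andP[].
have ut' : u < t by move: ut; rewrite in_itv /= => /andP[].
have us : ball 0 s u.
  by rewrite /ball /= sub0r normrN gtr0_norm //; apply: lt_trans ut' trs.2.
have := Hs u us (lt0r_neq0 u0).
rewrite /= addr0 [_%:A]mulr1 subr0 pmulr_rgt0 ?invr_gt0 // => du.
have tin : t \in `[0, t]%R by rewrite in_itv /= lexx ltW.
have [+ _] := Hr t (itr t tin); rewrite -subr_le0 E subr0.
by rewrite leNgt mulr_gt0.
Unshelve. all: by end_near.
Qed.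

Lemma is_derive_lincomb (V : normedModType R) (n : nat) (c : 'I_n -> R)
    (F : 'I_n -> V -> R) (dF : 'I_n -> R) (x v : V) :
  (forall i, is_derive x v (F i) (dF i)) ->
  is_derive x v (fun y => \sum_i c i * F i y) (\sum_i c i * dF i).
Proof.
move=> hF; have -> : (fun y => \sum_i c i * F i y) = \sum_i (c i *: F i).
  by apply/funext => y; rewrite fct_sumE.
by apply: is_derive_sum => i; exact: is_deriveZ.
Qed.

Lemma near_line (V : normedModType R) (U : set V) (q v : V) :
  open U -> U q -> \forall t \near (0 : R), U (q + t *: v).
Proof.
move=> Uo Uq.
have : {for (0 : R), continuous (fun t : R => q + t *: v)}.
  by apply: continuousD; [exact: cst_continuous|exact: scalel_continuous].
move=> /(_ U) /=; rewrite scale0r addr0; apply.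
exact: open_nbhs_nbhs.
Qed.

Lemma derive_at_max (V : normedModType R) (U : set V) (h dh : V -> R)
    (q e : V) :
  open U -> U q -> (forall y, U y -> h y <= h q) ->
  (forall y, U y -> is_derive y e h (dh y)) -> dh q = 0.
Proof.
move=> Uo Uq hmax hd; have nearq := near_line e Uo Uq.
have := @derive_at_max_real (fun t => h (q + t *: e)) (fun t => dh (q + t *: e)).
rewrite scale0r addr0; apply.
- by apply: filterS nearq => t /hmax.
- by apply: filterS nearq => t Ut; apply: is_derive_line; exact: hd.
Qed.

(** The quadratic form of the Hessian at a maximum is nonpositive on every vector, not
    only on the coordinate vectors; this is what a trace in an arbitrary frame
    requires.  The partial derivatives are given as functions [h1] and [h2] because the
    formula known for them is valid on [U] only. *)
Lemma second_derivative_max (n : nat) (U : set 'rV[R]_n) (h : 'rV[R]_n -> R)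
    (h1 : 'I_n -> 'rV[R]_n -> R) (h2 : 'I_n -> 'I_n -> 'rV[R]_n -> R)
    (q v : 'rV[R]_n) :
  open U -> U q -> (forall y, U y -> h y <= h q) ->
  (forall i y, U y -> is_derive y (delta_mx 0 i) h (h1 i y) /\
    {for y, continuous (h1 i)}) ->
  (forall i j y, U y -> is_derive y (delta_mx 0 j) (h1 i) (h2 i j y) /\
    {for y, continuous (h2 i j)}) ->
  \sum_i v 0 i * (\sum_j v 0 j * h2 i j q) <= 0.
Proof.
move=> Uo Uq hmax Dh Dh1.
have dirU (g : 'rV[R]_n -> R) (dg : 'I_n -> 'rV[R]_n -> R) (y : 'rV[R]_n) :
    U y ->
    (forall i y, U y -> is_derive y (delta_mx 0 i) g (dg i y) /\
      {for y, continuous (dg i)}) ->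
    is_derive y v g (\sum_i v 0 i * dg i y).
  move=> Uy hg; rewrite {1}[v]row_sum_delta.
  apply: is_derive_dir_sum => i; last by case: (hg i y Uy).
  by apply: filterS (open_nbhs_nbhs (conj Uo Uy)) => z /(hg i)[].
have nearq := near_line v Uo Uq.
apply: (@second_derivative_max_real (fun t => h (q + t *: v))
  (fun t => \sum_i v 0 i * h1 i (q + t *: v))).
- by apply: filterS nearq => t /hmax; rewrite scale0r addr0.
- apply: filterS nearq => t Ut; apply: is_derive_line; exact: dirU.
- apply: is_derive_lincomb => i.
  apply: (@is_derive_line _ (h1 i)).
  rewrite scale0r addr0; apply: dirU => //.
  by move=> j y; exact: Dh1.
Qed.

Lemma is_derive_prod (V : normedModType R) (f g : V -> R) (x v : V)
    (df dg : R) : is_derive x v f df -> is_derive x v g dg ->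
  is_derive x v (fun y => f y * g y) (df * g x + f x * dg).
Proof.
move=> hf hg; have H := is_deriveM hf hg.
by rewrite addrC [df * _]mulrC; exact: H.
Qed.

Lemma is_derive_dot (V : normedModType R) (m : nat) (f g : V -> 'rV[R]_m)
    (x e : V) : derivable f x e -> derivable g x e ->
  is_derive x e (fun y => dot (f y) (g y))
    (dot ('D_e f x) (g x) + dot (f x) ('D_e g x)).
Proof.
move=> df dg; rewrite /dot -big_split /=.
have fi := (derivable_mxP _ _ _).1 df 0.
have gi := (derivable_mxP _ _ _).1 dg 0.
have -> : (fun y => \sum_i f y 0 i * g y 0 i) =
    \sum_i (fun y => f y 0 i * g y 0 i).
  by apply/funext => y; rewrite fct_sumE.
rewrite (derive_mx df) (derive_mx dg).
apply: is_derive_sum => i; rewrite !mxE.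
by have := is_derive_prod (derivableP (fi i)) (derivableP (gi i)).
Qed.

Lemma is_derive_lorentz (V : normedModType R) (m : nat)
    (f g : V -> 'rV[R]_m.+1) (x e : V) : derivable f x e -> derivable g x e ->
  is_derive x e (fun y => lorentz (f y) (g y))
    (lorentz ('D_e f x) (g x) + lorentz (f x) ('D_e g x)).
Proof.
move=> df dg.
have dsp (k : V -> 'rV[R]_m.+1) : derivable k x e ->
    is_derive x e (fun y => space (k y)) (space ('D_e k x)).
  move=> dk; have dk' := (derivable_mxP _ _ _).1 dk.
  have dsk : derivable (fun y => space (k y)) x e.
    apply/derivable_mxP => i j.
    have -> : (fun y => space (k y) i j) = (fun y => k y 0 (lift ord0 j)).
      by apply/funext => y; rewrite mxE.
    exact: dk'.
  split=> //; rewrite (derive_mx dk) (derive_mx dsk).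
  apply/rowP => j; rewrite !mxE.
  by congr ('D_e _ x); apply/funext => y; rewrite mxE.
have dt (k : V -> 'rV[R]_m.+1) : derivable k x e ->
    is_derive x e (fun y => time (k y)) (time ('D_e k x)).
  move=> dk; have dk' := (derivable_mxP _ _ _).1 dk 0 ord0.
  by split=> //; rewrite (derive_mx dk) /time !mxE.
have [sf Sf] := dsp _ df; have [sg Sg] := dsp _ dg.
have D1 := is_derive_dot sf sg; rewrite Sf Sg in D1.
have D2 := is_derive_prod (dt _ df) (dt _ dg).
have D3 := is_deriveB D1 D2.
have -> : lorentz ('D_e f x) (g x) + lorentz (f x) ('D_e g x) =
    dot (space ('D_e f x)) (space (g x)) + dot (space (f x)) (space ('D_e g x)) -
    (time ('D_e f x) * time (g x) + time (f x) * time ('D_e g x)).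
  by rewrite /lorentz; ring.
exact: D3.
Qed.

End Calculus.

(** * Continuity of the pairings *)

Section Continuity.
Variable R : realType.

Lemma cvg_sum_ord (T : Type) (F : set_system T) {FF : Filter F} (n : nat)
    (f : 'I_n -> T -> R) (a : 'I_n -> R) :
  (forall i, f i @ F --> a i) ->
  (fun t => \sum_i f i t) @ F --> \sum_i a i.
Proof.
move=> fa; apply: (@cvg_big R _ (fun x y => x + y)) => //.
exact: add_continuous.
Qed.

Lemma cvg_coord (T : Type) (F : set_system T) {FF : Filter F} (m n : nat)
    (f : T -> 'M[R]_(m, n)) (a : 'M[R]_(m, n)) i j :
  f @ F --> a -> (fun t => f t i j) @ F --> a i j.
Proof.
by move=> fa; apply: (@cvg_comp _ _ _ f (fun M => M i j) _ _ _ fa);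
  exact: coord_continuous.
Qed.

Lemma cvg_dot (T : Type) (F : set_system T) {FF : Filter F} (m : nat)
    (f g : T -> 'rV[R]_m) (a b : 'rV[R]_m) :
  f @ F --> a -> g @ F --> b ->
  (fun t => dot (f t) (g t)) @ F --> dot a b.
Proof.
move=> fa gb; apply: (@cvg_sum_ord _ _ _ _ (fun i t => f t 0 i * g t 0 i)).
by move=> i; apply: cvgM; exact: cvg_coord.
Qed.

Lemma cvg_lorentz (T : Type) (F : set_system T) {FF : Filter F} (m : nat)
    (f g : T -> 'rV[R]_m.+1) (a b : 'rV[R]_m.+1) :
  f @ F --> a -> g @ F --> b ->
  (fun t => lorentz (f t) (g t)) @ F --> lorentz a b.
Proof.
move=> fa gb; apply: cvgB; last by apply: cvgM; exact: cvg_coord.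
apply: (@cvg_sum_ord _ _ _ _ (fun i t => space (f t) 0 i * space (g t) 0 i)).
move=> i; rewrite !mxE; under eq_fun do rewrite !mxE.
by apply: cvgM; exact: cvg_coord.
Qed.

End Continuity.

(** * Adapted frames of Minkowski space *)

Section Frame.
Variables (R : realType) (n : nat).
Implicit Types (F : 'M[R]_(n, n.+2)) (p N w nu : 'rV[R]_n.+2).

Lemma lorentz_mulmx (k : nat) (v : 'rV[R]_k) (F : 'M[R]_(k, n.+2)) w :
  lorentz (v *m F) w = \sum_i v 0 i * lorentz (row i F) w.
Proof.
rewrite mulmx_sum_row lorentz_suml; apply: eq_bigr => i _.
by rewrite lorentzZl.
Qed.

(** Otherwise [F], [p], [N] and [w] would be [n + 3] independent vectors of a space of
    dimension [n + 2]: a vanishing combination is killed by pairing it with [p], [N]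
    and [w] in turn, where [lorentz w w > 0] as [w] is orthogonal to [p]. *)
Lemma orth_frame_eq0 F p N w : lorentz p p < 0 -> lorentz N N = 1 ->
  lorentz N p = 0 -> row_free F ->
  (forall i, lorentz (row i F) p = 0) -> (forall i, lorentz (row i F) N = 0) ->
  lorentz w p = 0 -> lorentz w N = 0 -> (forall i, lorentz (row i F) w = 0) ->
  w = 0.
Proof.
move=> pp NN Np Ff Fp FN wp wN Fw; apply: contrapT => /eqP w0.
have ww : 0 < lorentz w w by apply: (orth_timelike pp) => //; rewrite lorentzC.
pose M := col_mx F (col_mx p (col_mx N w)).
have F_orth z (v : 'rV_n) : (forall i, lorentz (row i F) z = 0) ->
    lorentz (v *m F) z = 0.
  by move=> Fz; rewrite lorentz_mulmx big1 // => i _; rewrite Fz mulr0.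
have /eqP rM : row_free M.
  apply: inj_row_free => u.
  rewrite -[u]hsubmxK mul_row_col -[rsubmx u]hsubmxK mul_row_col.
  rewrite -[rsubmx (rsubmx u)]hsubmxK mul_row_col.
  move: (lsubmx u) (lsubmx (rsubmx u)) (lsubmx (rsubmx (rsubmx u)))
    (rsubmx (rsubmx (rsubmx u))) => v x y z.
  rewrite (mx11_scalar x) (mx11_scalar y) (mx11_scalar z) !mul_scalar_mx.
  move: (x 0 0) (y 0 0) (z 0 0) => {}x {}y {}z E.
  have pair k : lorentz (v *m F + (x *: p + (y *: N + z *: w))) k = 0.
    by rewrite E lorentz0l.
  have := pair p; rewrite !lorentzE F_orth // Np wp !mulr0 !addr0 add0r => /eqP.
  rewrite mulf_eq0 (lt_eqF pp) orbF => /eqP x0.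
  have := pair N; rewrite !lorentzE F_orth // NN wN x0 mul0r mulr0 mulr1 addr0 !add0r.
  move=> y0.
  have := pair w; rewrite !lorentzE F_orth // x0 y0 !mul0r !add0r => /eqP.
  rewrite mulf_eq0 (gt_eqF ww) orbF => /eqP z0.
  move: E; rewrite x0 y0 z0 !scale0r !addr0 => vF.
  have -> : v = 0 by apply: (row_free_inj Ff); rewrite mul0mx.
  by rewrite raddf0 !row_mx0.
have := rank_leq_col M; rewrite rM.
by rewrite !addnS addn0 ltnn.
Qed.

(** A vector orthogonal to the tangent vectors of a hypersurface of hyperbolic space
    is determined by its pairings with the position and the unit normal. *)
Lemma normal_decomposition F p N nu : lorentz p p = -1 -> lorentz N N = 1 ->
  lorentz N p = 0 -> row_free F ->
  (forall i, lorentz (row i F) p = 0) -> (forall i, lorentz (row i F) N = 0) ->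
  (forall i, lorentz (row i F) nu = 0) ->
  nu = - lorentz p nu *: p + lorentz N nu *: N.
Proof.
move=> pp NN Np Ff Fp FN Fnu; apply/eqP; rewrite -subr_eq0; apply/eqP.
apply: (@orth_frame_eq0 F p N) => //.
- by rewrite pp ltrN10.
- rewrite !lorentzE pp Np (lorentzC nu); ring.
- rewrite !lorentzE NN (lorentzC p N) Np (lorentzC nu); ring.
- by move=> i; rewrite !lorentzE Fp FN Fnu; ring.
Qed.

End Frame.

(** * Curvature at a highest point *)

Section Touching.
Variable R : realType.

Lemma quad_formE (n : nat) (B : 'M[R]_n) (v : 'rV[R]_n) :
  quad_form B v = \sum_i v 0 i * (\sum_j v 0 j * B i j).
Proof.
rewrite /quad_form -mulmxA mxE; apply: eq_bigr => i _; rewrite mxE.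
by congr (_ * _); apply: eq_bigr => j _; rewrite mxE mulrC.
Qed.

(** With [orth_timelike], this makes the first fundamental form positive definite. *)
Lemma quad_form_gram (n m : nat) (F : 'M[R]_(n, m.+2)) (v : 'rV[R]_n) :
  quad_form (\matrix_(i, j) lorentz (row i F) (row j F)) v =
  lorentz (v *m F) (v *m F).
Proof.
rewrite quad_formE lorentz_mulmx; apply: eq_bigr => i _; congr (_ * _).
rewrite lorentzC lorentz_mulmx; apply: eq_bigr => j _.
by rewrite mxE lorentzC.
Qed.

(** The mean curvature only enters through the trace of the shape operator, which
    the characteristic polynomial determines. *)
Lemma sum_principal_curvatures (n : nat) (f : 'rV[R]_n -> 'rV[R]_n.+2)
    (q : 'rV[R]_n) (N : 'rV[R]_n.+2) (k : 'I_n -> R) : (0 < n)%N ->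
  principal_curvatures f q N k -> \sum_i k i = \tr (shape_operator f q N).
Proof.
rewrite /principal_curvatures => n0 E.
have := char_poly_trace (shape_operator f q N) n0; rewrite E.
pose ps := [seq k i | i <- index_enum 'I_n].
have sps : size ps = n by rewrite size_map -[index_enum _]enumT size_enum_ord.
have -> : \prod_(i < n) ('X - (k i)%:P) = \prod_(x <- ps) ('X - x%:P).
  by rewrite big_map.
rewrite -{1}sps coefPn_prod_XsubC ?sps -?lt0n // big_map => /oppr_inj.
by [].
Qed.

Lemma lorentz_geodesic (n : nat) (p N nu : 'rV[R]_n.+2) (t : R) :
  lorentz (geodesic p N t) nu =
  (expR t + expR (- t)) / 2 * lorentz p nu +
  (expR t - expR (- t)) / 2 * lorentz N nu.
Proof. by rewrite /geodesic !lorentzE. Qed.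

(** If the normal towards [Dp] pointed down, the geodesic leaving [p] in the opposite
    direction would rise into [Dp], although it must enter [Dm]. *)
Lemma normal_points_up (n : nat) (Dp Dm : set 'rV[R]_n.+2)
    (p N nu : 'rV[R]_n.+2) :
  Dm `<=` @hyp R n -> Dp `&` Dm = set0 ->
  (forall x, hyp x -> lorentz p nu < lorentz x nu -> Dp x) ->
  points_from_to Dm Dp p N ->
  lorentz N nu ^+ 2 = 1 + lorentz p nu ^+ 2 ->
  0 < lorentz N nu.
Proof.
move=> Dmh DD above pts r2; rewrite ltNge; apply/negP => r0.
have [t [t0 [_ Dmt]]] : exists t : R, 0 < t /\
    (Dp (geodesic p N t) /\ Dm (geodesic p N (- t))).
  have [t ?] := @filter_ex _ _ (at_right_proper_filter (0 : R)) _
    (filterI (nbhs_right_gt (0 : R)) pts).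
  by exists t.
have : (Dp `&` Dm) (geodesic p N (- t)).
  split=> //; apply: above; first exact: Dmh.
  rewrite lorentz_geodesic opprK.
  move: r2 r0; move: (lorentz p nu) (lorentz N nu) => s r r2 r0.
  have E1 : 1 < expR t by rewrite expR_gt1.
  have E0 : 0 < expR t by rewrite expR_gt0.
  rewrite expRN; move: (expR t) E0 E1 => E E0 E1.
  have sr1 : 0 < - r - s.
    rewrite ltNge; apply/negP => h.
    have : (- r) ^+ 2 <= s ^+ 2 by rewrite ler_pXn2r ?nnegrE //; lra.
    by rewrite sqrrN r2; lra.
  have sr2 : 0 < - r + s.
    rewrite ltNge; apply/negP => h.
    have : (- r) ^+ 2 <= (- s) ^+ 2 by rewrite ler_pXn2r ?nnegrE //; lra.
    by rewrite !sqrrN r2; lra.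
  rewrite -subr_gt0.
  have -> : (E^-1 + E) / 2 * s + (E^-1 - E) / 2 * r - s =
     (E - 1) * ((- r - s) + E * (- r + s)) / (2 * E) by field; rewrite gt_eqF.
  rewrite divr_gt0 ?mulr_gt0 ?subr_gt0 // addr_gt0 ?mulr_gt0 //.
by rewrite DD.
Qed.

(** The comparison at a highest point [p]: there [nu] has no tangential part, so that
    [nu = - s p + r N] with [r^2 = 1 + s^2].  Since second derivatives of a
    parametrisation [f] pair with the position vector to minus the first fundamental
    form, the Hessian of the height is [s g + r II], and its trace with respect to
    [g] is [n (s + r h)]. *)
Lemma touching_height (n : nat) (S Dp Dm : set 'rV[R]_n.+2)
    (p nu : 'rV[R]_n.+2) (h : R) :
  (0 < n)%N -> S `<=` @hyp R n -> Dm `<=` @hyp R n -> Dp `&` Dm = set0 ->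
  lorentz nu nu = 1 -> S p ->
  (forall x, S x -> lorentz x nu <= lorentz p nu) ->
  (forall x, hyp x -> lorentz p nu < lorentz x nu -> Dp x) ->
  mean_curvature_at S Dp Dm p h ->
  lorentz p nu + h * Num.sqrt (1 + lorentz p nu ^+ 2) <= 0.
Proof.
move=> n0 Sh Dmh DD nn Sp hmax above.
move=> [U [f [q [N [k [[[Uo Uq fq Cf [_ fS]] imm] [NN Np Nf] pts pc hE]]]]]].
have fU y : U y -> S (f y).
  move=> Uy; have [W _ E] := fS U Uo (fun x => id).
  have : (f @` U) (f y) by exists y.
  by rewrite E => -[].
have nearU y : U y -> nbhs y U by move=> Uy; apply: open_nbhs_nbhs.
have [cf Cf1] := Cf.
have df i y : U y -> derivable f y (delta_mx 0 i) by case: (Cf1 i) => H _; exact: H.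
have cdf i y : U y -> {for y, continuous (partial i f)}.
  by case: (Cf1 i) => _ [H _]; exact: H.
have ddf i j y : U y -> derivable (partial i f) y (delta_mx 0 j).
  by case: (Cf1 i) => _ [_ H]; case: (H j) => H' _; exact: H'.
have cddf i j y : U y -> {for y, continuous (partial j (partial i f))}.
  by case: (Cf1 i) => _ [_ H]; case: (H j) => _ [H' _]; exact: H'.
have Dpair (g : 'rV[R]_n -> 'rV[R]_n.+2) i y : derivable g y (delta_mx 0 i) ->
    is_derive y (delta_mx 0 i) (fun y => lorentz (g y) nu)
      (lorentz (partial i g y) nu).
  move=> dg; have := is_derive_lorentz dg (derivable_cst nu y (delta_mx 0 i)).
  by rewrite derive_cst [X in _ + X]lorentzC lorentz0l addr0.
have Cpair (g : 'rV[R]_n -> 'rV[R]_n.+2) y : {for y, continuous g} ->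
    {for y, continuous (fun y => lorentz (g y) nu)}.
  move=> cg; apply: (@cvg_lorentz R _ (nbhs y) _ _ g (fun=> nu)) => //.
  exact: cvg_cst.
have cst_derive (g : 'rV[R]_n -> R) (c d : R) i y : U y ->
    (forall z, U z -> g z = c) -> is_derive y (delta_mx 0 i) g d -> d = 0.
  move=> Uy gc [_ <-].
  rewrite (@near_eq_derive _ _ _ g (cst c)) ?derive_cst //.
  by apply: filterS (nearU y Uy) => z; exact: gc.
(* differentiate the equation of the hyperboloid *)
have tangent i y : U y -> lorentz (partial i f y) (f y) = 0.
  move=> Uy; have D := is_derive_lorentz (df i y Uy) (df i y Uy).
  have : forall z, U z -> lorentz (f z) (f z) = -1 by move=> z /fU/Sh[].
  move=> /(cst_derive _ _ _ _ _ Uy)/(_ D).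
  by rewrite [X in _ + X = _]lorentzC => H; rewrite /partial; lra.
(* differentiate the previous orthogonality relation once more *)
have second i j : lorentz (partial j (partial i f) q) p =
    - lorentz (partial i f q) (partial j f q).
  have D := is_derive_lorentz (ddf i j q Uq) (df j q Uq).
  have := cst_derive _ _ _ _ _ Uq (tangent i) D.
  by rewrite fq => /eqP; rewrite addr_eq0 => /eqP.
pose F : 'M[R]_(n, n.+2) := \matrix_(i < n, j < n.+2) partial i f q 0 j.
have rowF i : row i F = partial i f q by apply/rowP => j; rewrite !mxE.
have Ff : row_free F by exact: imm.
have pp : lorentz p p = -1 by case: (Sh p Sp).
rewrite fq in Np.
have Fp i : lorentz (row i F) p = 0 by rewrite rowF -fq tangent.
have FN i : lorentz (row i F) N = 0 by rewrite rowF lorentzC.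
have hle y : U y -> lorentz (f y) nu <= lorentz (f q) nu.
  by move=> /fU/hmax; rewrite fq.
have Hess (v : 'rV[R]_n) : \sum_i v 0 i * (\sum_j v 0 j *
    lorentz (partial j (partial i f) q) nu) <= 0.
  apply: (@second_derivative_max _ n U (fun y => lorentz (f y) nu)
    (fun i y => lorentz (partial i f y) nu)
    (fun i j y => lorentz (partial j (partial i f) y) nu) q v Uo Uq hle).
  - by move=> i y Uy; split; [exact/Dpair/df|exact/Cpair/cdf].
  - by move=> i j y Uy; split; [exact/Dpair/ddf|exact/Cpair/cddf].
have Fnu i : lorentz (row i F) nu = 0.
  rewrite rowF.
  apply: (@derive_at_max _ _ U (fun y => lorentz (f y) nu)
    (fun y => lorentz (partial i f y) nu) q (delta_mx 0 i) Uo Uq hle).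
  by move=> y Uy; exact/Dpair/df.
have nuE := normal_decomposition pp NN Np Ff Fp FN Fnu.
set s := lorentz p nu in nuE *; set r := lorentz N nu in nuE.
have r2 : r ^+ 2 = 1 + s ^+ 2.
  have := nn; rewrite {1}nuE !lorentzE -/s -/r => <-; ring.
have r0 : 0 < r by exact: (normal_points_up Dmh DD above pts r2).
rewrite -r2 sqrtr_sqr gtr0_norm //.
set g := first_form f q; set II := second_form f q N.
have gE : g = \matrix_(i, j) lorentz (row i F) (row j F).
  by apply/matrixP => i j; rewrite !mxE !rowF.
have gT : g^T = g.
  rewrite gE; apply/matrixP => i j; rewrite !mxE.
  exact: lorentzC.
have gpos v : v != 0 -> 0 < quad_form g v.
  move=> v0; rewrite gE quad_form_gram.
  apply: (@orth_timelike _ _ p); first by rewrite pp ltrN10.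
    rewrite lorentzC lorentz_mulmx big1 // => i _.
    by rewrite Fp mulr0.
  apply: contra v0 => /eqP vF; apply/eqP.
  by apply: (row_free_inj Ff); rewrite mul0mx.
have B0 v : 0 <= quad_form (- (s *: g + r *: II)) v.
  rewrite quad_formE -oppr_le0 -sumrN; apply: le_trans (Hess v).
  rewrite le_eqVlt; apply/orP; left; apply/eqP.
  (* the second form differentiates in the opposite order, hence the exchange *)
  under eq_bigr do rewrite -mulrN -sumrN mulr_sumr.
  rewrite exchange_big /=; apply: eq_bigr => j _; rewrite mulr_sumr.
  apply: eq_bigr => i _.
  have -> : lorentz (partial i (partial j f) q) nu = s * g j i + r * II i j.
    rewrite nuE !lorentzE second !mxE; ring.
  rewrite !mxE (lorentzC (partial j f q)); ring.
have := trace_posdef_ge0 gT gpos B0.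
have gu := posdef_unitmx gT gpos.
rewrite mulmxN mulmxDr -!scalemxAr mulVmx // linearN /= linearD /= !linearZ /=.
rewrite mxtrace1 oppr_ge0 -[invmx g *m II]/(shape_operator f q N).
rewrite -(sum_principal_curvatures n0 pc).
have -> : \sum_i k i = h * n%:R by rewrite hE divfK // pnatr_eq0 -lt0n.
by rewrite mulrA -mulrDl pmulr_lle0 ?ltr0n // (mulrC h).
Qed.

End Touching.

(** * Connectedness of the sphere at infinity *)

Section Paths.
Variable R : realType.

(** The set [C `&` A] is relatively open and relatively closed in [C]. *)
Lemma connected_relopen (m : nat) (S A B C : set 'rV[R]_m) (x y : 'rV[R]_m) :
  connected C -> rel_open S A -> rel_open S B -> A `&` B = set0 ->
  C `<=` S -> C `<=` A `|` B -> C x -> A x -> C y -> A y.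
Proof.
move=> Cc [W Wo AE] [W' W'o BE] AB CS CAB Cx Ax Cy.
have CA : C `&` A = C.
  apply: Cc; first by exists x.
    exists W => //; rewrite AE setIA; congr (_ `&` _).
    by apply/seteqP; split=> [z []|z Cz] //; split=> //; exact: CS.
  exists (~` W'); first exact: open_closedC.
  apply/seteqP; split=> z [Cz].
    move=> Az; split=> // W'z.
    have : (A `&` B) z by split=> //; rewrite BE; split=> //; exact: CS.
    by rewrite AB.
  move=> W'z; split=> //; case: (CAB z Cz) => //; rewrite BE => -[_ /W'z].
  by [].
by move: Cy; rewrite -CA => -[].
Qed.

Lemma path_relopen (m : nat) (S A B : set 'rV[R]_m) (gam : R -> 'rV[R]_m) :
  rel_open S A -> rel_open S B -> A `&` B = set0 ->
  (forall t, 0 <= t <= 1 -> {for t, continuous gam}) ->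
  (forall t, 0 <= t <= 1 -> S (gam t) /\ (A `|` B) (gam t)) ->
  A (gam 0) -> A (gam 1).
Proof.
move=> Ao Bo AB gc gS A0.
have in01 (t : R) : `[0, 1]%classic t -> 0 <= t <= 1 by rewrite /= in_itv.
apply: (@connected_relopen m S A B (gam @` `[0, 1]%classic) (gam 0)) => //.
- apply: connected_continuous_connected; first exact: segment_connected.
  apply: continuous_in_subspaceT => t; rewrite inE => /in01.
  exact: gc.
- by move=> _ [t /in01/gS[? _] <-].
- by move=> _ [t /in01/gS[_ ?] <-].
- by exists 0; rewrite //= in_itv /= lexx ler01.
- by exists 1; rewrite //= in_itv /= lexx ler01.
Qed.

End Paths.

Section SphereConnected.
Variables (R : realType) (n : nat).

(** Two points that are not antipodal are joined by the normalised segment. *)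
Lemma sphere_connected_close (A B : set 'rV[R]_n.+1) (xi eta : 'rV[R]_n.+1) :
  rel_open (@sphere_inf R n) A -> rel_open (@sphere_inf R n) B ->
  A `&` B = set0 -> A `|` B = @sphere_inf R n ->
  A xi -> B eta -> -1 < dot xi eta -> False.
Proof.
move=> Ao Bo AB AuB Axi Beta d1.
have sA z : A z -> dot z z = 1.
  by move=> Az; suff : sphere_inf z by []; rewrite -AuB; left.
have sB z : B z -> dot z z = 1.
  by move=> Az; suff : sphere_inf z by []; rewrite -AuB; right.
pose z (t : R) := (1 - t) *: xi + t *: eta.
have zz t : dot (z t) (z t) = 1 - 2 * (t * (1 - t)) * (1 - dot xi eta).
  rewrite /z !(dotDl, dotDr, dotZl, dotZr) sA // sB // (dotC eta xi); ring.
have zz0 t : 0 < dot (z t) (z t).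
  have d2 : dot xi eta <= 1.
    have := dot_ge0 (xi + (-1) *: eta).
    rewrite !(dotDl, dotDr, dotZl, dotZr) sA // sB // (dotC eta xi); lra.
  have X4 : t * (1 - t) <= 4^-1 by have := sqr_ge0 (1 - 2 * t); nra.
  have := ler_wpM2r (_ : 0 <= 1 - dot xi eta) X4; rewrite subr_ge0 => /(_ d2).
  by rewrite zz; lra.
pose gam t := (Num.sqrt (dot (z t) (z t)))^-1 *: z t.
have gs t : sphere_inf (gam t).
  rewrite /sphere_inf /= /gam dotZl dotZr mulrA -invfM -expr2 sqr_sqrtr ?ltW //.
  by rewrite mulVf // gt_eqF.
have zc t : {for t, continuous z}.
  apply: cvgD; last by apply: cvgZr_tmp; exact: cvg_id.
  by apply: cvgZr_tmp; apply: cvgB; [exact: cvg_cst|exact: cvg_id].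
have gc t : {for t, continuous gam}.
  apply: cvgZ; last exact: zc.
  apply: cvgV; first by rewrite gt_eqF // sqrtr_gt0.
  apply: (@cvg_comp _ _ _ (fun t => dot (z t) (z t)) Num.sqrt).
    by apply: cvg_dot; exact: zc.
  exact: sqrt_continuous.
have gAB t : 0 <= t <= 1 -> sphere_inf (gam t) /\ (A `|` B) (gam t).
  by move=> _; rewrite AuB; split; exact: gs.
have gam0 : gam 0 = xi.
  by rewrite /gam /z subr0 scale1r scale0r addr0 (sA xi) // sqrtr1 invr1 scale1r.
have gam1 : gam 1 = eta.
  by rewrite /gam /z subrr scale1r scale0r add0r (sB eta) // sqrtr1 invr1 scale1r.
have := path_relopen Ao Bo AB (fun t _ => gc t) gAB; rewrite gam0 gam1.
move=> /(_ Axi) Aeta; have : (A `&` B) eta by [].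
by rewrite AB.
Qed.

(** For antipodal points go through a third one, which is a coordinate vector [e]
    different from both; it exists as soon as there are two coordinates. *)
Lemma sphere_connected (A B : set 'rV[R]_n.+1) : (0 < n)%N ->
  rel_open (@sphere_inf R n) A -> rel_open (@sphere_inf R n) B ->
  A `&` B = set0 -> A `|` B = @sphere_inf R n ->
  A !=set0 -> B !=set0 -> False.
Proof.
move=> n0 Ao Bo AB AuB [xi Axi] [eta Beta].
have sxi : sphere_inf xi by rewrite -AuB; left.
have seta : sphere_inf eta by rewrite -AuB; right.
have [d1|d1] := ltP (-1) (dot xi eta).
  exact: (@sphere_connected_close A B xi eta).
have etaE : eta = - xi.
  apply/eqP; rewrite -addr_eq0; apply/eqP/dot_eq0/eqP.
  rewrite eq_le dot_ge0 andbT !(dotDl, dotDr) sxi seta (dotC eta).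
  lra.
(* two coordinates of square at least 1 would make xi too long *)
have [i xi_i] : exists i, xi 0 i ^+ 2 < 1.
  apply: contrapT => /forallNP H.
  have n1 : (1 < n.+1)%N by [].
  move: sxi; rewrite /sphere_inf /= /dot (bigD1 ord0) //= (bigD1 (Ordinal n1)) //=.
  have := H ord0; have := H (Ordinal n1) => /negP; rewrite -leNgt => h1 /negP.
  rewrite -leNgt => h0 E.
  have : 0 <= \sum_(i < n.+1 | (i != ord0) && (i != Ordinal n1)) xi 0 i * xi 0 i.
    by apply: sumr_ge0 => j _; rewrite -expr2 sqr_ge0.
  by rewrite !expr2 in h0 h1; lra.
pose e : 'rV[R]_n.+1 := delta_mx 0 i.
have dote z : dot z e = z 0 i.
  rewrite /dot (bigD1 i) //= mxE !eqxx mulr1 big1 ?addr0 // => j ji.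
  by rewrite mxE eqxx (negPf ji) mulr0.
have se : sphere_inf e by rewrite /sphere_inf /= dote mxE !eqxx.
have : `|xi 0 i| < 1 by rewrite -(@expr_lt1 _ 2) // real_normK ?num_real.
rewrite ltr_norml => /andP[l1 l2].
have : (A `|` B) e by rewrite AuB.
case=> [Ae|Be].
  apply: (@sphere_connected_close A B e eta) => //.
  by rewrite etaE dotNr dotC dote ltrN2.
by apply: (@sphere_connected_close A B xi e) => //; rewrite dote.
Qed.

End SphereConnected.

(** * Points and regions of prescribed height *)

Section Equidistant.
Variables (R : realType) (n : nat).
Implicit Types (nu x y z : 'rV[R]_n.+2) (a : 'rV[R]_n.+1) (c s t : R).

Definition orth_part nu z := z - lorentz z nu *: nu.

(** The point of height [t] on the curve through [z] orthogonal to the equidistant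
    hypersurfaces of [nu]: the direction of the orthogonal part of [z] is kept, its
    length is the one required by the hyperboloid.  For timelike [z] off
    the hyperboloid this is also a projection onto it. *)
Definition at_height nu z t :=
  t *: nu + Num.sqrt ((1 + t ^+ 2) / - lorentz (orth_part nu z) (orth_part nu z))
            *: orth_part nu z.

Lemma lorentz_orth_part nu z : lorentz nu nu = 1 ->
  lorentz (orth_part nu z) nu = 0.
Proof. by move=> nn; rewrite /orth_part !lorentzE nn; ring. Qed.

Lemma lorentz_orth_part_sqr nu z : lorentz nu nu = 1 ->
  lorentz (orth_part nu z) (orth_part nu z) = lorentz z z - lorentz z nu ^+ 2.
Proof.
by move=> nn; rewrite /orth_part !lorentzE nn (lorentzC nu); ring.
Qed.

Lemma orth_part_timelike nu z : lorentz nu nu = 1 -> lorentz z z < 0 ->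
  lorentz (orth_part nu z) (orth_part nu z) < 0.
Proof.
move=> nn zz; rewrite lorentz_orth_part_sqr //.
by have := sqr_ge0 (lorentz z nu); lra.
Qed.

Lemma lorentz_at_height nu z t : lorentz nu nu = 1 -> lorentz (at_height nu z t) nu = t.
Proof.
by move=> nn; rewrite /at_height 2!lorentzE !lorentzZl lorentz_orth_part // nn; ring.
Qed.

Lemma hyp_at_height nu z t : lorentz nu nu = 1 -> lorentz z z < 0 -> 0 < time z ->
  hyp (at_height nu z t).
Proof.
move=> nn zz tz.
have ww := orth_part_timelike nn zz; have wn := lorentz_orth_part z nn.
have zE : z = orth_part nu z + lorentz z nu *: nu by rewrite subrK.
rewrite /at_height; move: (orth_part nu z) ww wn zE => w ww wn zE.
have wz : lorentz w z = lorentz w w.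
  by rewrite {1}zE lorentzDr lorentzZr wn mulr0 addr0.
have tw : 0 < time w.
  by apply: (future_of_lorentz_lt0 ww zz tz); rewrite wz.
have k0 : 0 < (1 + t ^+ 2) / - lorentz w w.
  by rewrite divr_gt0 ?oppr_gt0 // ltr_wpDr ?sqr_ge0.
set k := Num.sqrt _.
have k2 : k ^+ 2 = (1 + t ^+ 2) / - lorentz w w by rewrite sqr_sqrtr // ltW.
have {}k0 : 0 < k by rewrite sqrtr_gt0.
have qt : lorentz (t *: nu + k *: w) (t *: nu + k *: w) = -1.
  rewrite !lorentzE (lorentzC nu w) wn nn.
  rewrite [LHS](_ : _ = t ^+ 2 + k ^+ 2 * lorentz w w); last by ring.
  by rewrite k2; field; rewrite lt_eqF.
split=> //; apply: (@future_of_lorentz_lt0 _ _ _ w) => //.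
  by rewrite qt ltrN10.
by rewrite !lorentzE (lorentzC nu w) wn mulr0 add0r pmulr_rlt0.
Qed.

Lemma at_height_id nu x : lorentz nu nu = 1 -> hyp x -> at_height nu x (lorentz x nu) = x.
Proof.
move=> nn [xx _]; rewrite /at_height lorentz_orth_part_sqr // xx.
have -> : - (-1 - lorentz x nu ^+ 2) = 1 + lorentz x nu ^+ 2 by ring.
rewrite divff; last by rewrite gt_eqF // ltr_wpDr ?sqr_ge0.
by rewrite sqrtr1 scale1r /orth_part addrC subrK.
Qed.

Lemma cvg_at_height (T : Type) (F : set_system T) {FF : Filter F}
    (zf : T -> 'rV[R]_n.+2) (tf : T -> R) nu z t :
  lorentz nu nu = 1 -> lorentz z z < 0 ->
  zf @ F --> z -> tf @ F --> t ->
  (fun i => at_height nu (zf i) (tf i)) @ F --> at_height nu z t.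
Proof.
move=> nn zz zfz tft.
have vc : (fun i => orth_part nu (zf i)) @ F --> orth_part nu z.
  apply: cvgB => //; apply: cvgZr_tmp.
  by apply: cvg_lorentz => //; exact: cvg_cst.
have ww := orth_part_timelike nn zz.
apply: cvgD; first exact: cvgZr_tmp.
apply: cvgZ => //.
apply: (@cvg_comp _ _ _ (fun i => (1 + tf i ^+ 2) /
  - lorentz (orth_part nu (zf i)) (orth_part nu (zf i))) Num.sqrt); last first.
  exact: sqrt_continuous.
apply: cvgM.
  by apply: cvgD; [exact: cvg_cst|rewrite expr2; apply: cvgM].
apply: cvgV; first by rewrite oppr_eq0 lt_eqF.
by apply: cvgN; exact: cvg_lorentz.
Qed.

(** The region above height [s] need not be geodesically convex, but it is path
    connected: the affine segment between two of its points stays in the solid cone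
    above height [s], and [at_height] projects it back to the hyperboloid without
    changing heights. *)
Lemma upper_region_relopen (A B : set 'rV[R]_n.+2) nu s x y :
  lorentz nu nu = 1 ->
  rel_open (@hyp R n) A -> rel_open (@hyp R n) B -> A `&` B = set0 ->
  (forall z, hyp z -> s < lorentz z nu -> (A `|` B) z) ->
  hyp x -> hyp y -> s < lorentz x nu -> s < lorentz y nu -> A x -> A y.
Proof.
move=> nn Ao Bo AB AuB hx hy sx sy Ax.
pose z t := (1 - t) *: x + t *: y.
have zz t : 0 <= t <= 1 -> lorentz (z t) (z t) < 0 /\ 0 < time (z t).
  move=> /andP[t0 t1]; have [xx tx] := hx; have [yy ty] := hy.
  have xy := future_lorentz (hyp_timelike hx) (hyp_timelike hy) tx ty.
  split.
    rewrite /z !lorentzE xx yy (lorentzC y x); move: xy.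
    move: (lorentz x y) => d d0.
    have : t * (1 - t) * d <= 0.
      by rewrite mulr_ge0_le0 ?mulr_ge0 ?subr_ge0 // ltW.
    have := sqr_ge0 (1 - 2 * t); set b := _ ^+ 2 => b0 td.
    rewrite [X in X < 0](_ : _ = 2 * (t * (1 - t) * d) - (1 + b) / 2).
      lra.
    by rewrite /b; field.
  rewrite /z time_lin /time mxE; rewrite /time in tx ty.
  move: (x 0 ord0) (y 0 ord0) tx ty => p q p0 q0.
  have [->|t0'] := eqVneq t 0; first by rewrite subr0 mul1r mul0r addr0.
  have {}t0 : 0 < t by rewrite lt_neqAle eq_sym t0'.
  by rewrite ltr_wpDl ?mulr_gt0 // mulr_ge0 ?subr_ge0 // ltW.
pose gam t := at_height nu (z t) (lorentz (z t) nu).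
have zc t : {for t, continuous z}.
  apply: cvgD; last by apply: cvgZr_tmp; exact: cvg_id.
  by apply: cvgZr_tmp; apply: cvgB; [exact: cvg_cst|exact: cvg_id].
have gamc t : 0 <= t <= 1 -> {for t, continuous gam}.
  move=> /zz[zt _]; apply: cvg_at_height => //; first exact: zc.
  by apply: cvg_lorentz; [exact: zc|exact: cvg_cst].
have gam_region t : 0 <= t <= 1 -> hyp (gam t) /\ (A `|` B) (gam t).
  move=> t01; have [zt tzt] := zz t t01.
  have hg : hyp (gam t) by exact: hyp_at_height.
  split=> //; apply: AuB => //; rewrite lorentz_at_height //.
  rewrite /z !lorentzE; move/andP: t01 => [t0 t1].
  move: sx sy; move: (lorentz x nu) (lorentz y nu) => p q sp sq.
  rewrite -subr_gt0 [X in 0 < X](_ : _ = (1 - t) * (p - s) + t * (q - s));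
    last by ring.
  have [->|t0'] := eqVneq t 0; first by rewrite subr0 mul1r mul0r addr0 subr_gt0.
  rewrite ltr_wpDl //; first by rewrite mulr_ge0 ?subr_ge0 // ltW.
  by rewrite mulr_gt0 ?subr_gt0 // lt_neqAle eq_sym t0'.
have gam0 : gam 0 = x by rewrite /gam /z subr0 scale1r scale0r addr0 at_height_id.
have gam1 : gam 1 = y by rewrite /gam /z subrr scale1r scale0r add0r at_height_id.
have := path_relopen Ao Bo AB gamc gam_region.
by rewrite gam0 gam1; exact.
Qed.

(** Every point is the limit of points that lie strictly higher on the same curve. *)
Lemma closure_upper_region nu s x : lorentz nu nu = 1 -> hyp x ->
  s <= lorentz x nu ->
  closure [set y | hyp y /\ s < lorentz y nu] x.
Proof.
move=> nn hx sx V Vx.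
have [t [Vt xt]] : exists t, V (at_height nu x t) /\ lorentz x nu < t.
  have : (fun t => at_height nu x t) @ (lorentz x nu)^'+ --> x.
    rewrite -[X in _ --> X](at_height_id nn hx); apply: cvg_at_height => //.
    - exact: hyp_timelike.
    - exact: cvg_cst.
    - by apply: cvg_at_right_filter; exact: cvg_id.
  move=> /(_ V Vx) NV.
  have [t [? ?]] := @filter_ex _ _ (at_right_proper_filter (lorentz x nu)) _
    (filterI (nbhs_right_gt (lorentz x nu)) NV).
  by exists t.
have [xx tx] := hx.
exists (at_height nu x t); split=> //; split.
  by apply: hyp_at_height => //; rewrite xx ltrN10.
by rewrite lorentz_at_height //; apply: le_lt_trans xt.
Qed.

Definition mk_point c a : 'rV[R]_n.+2 :=
  \row_i (if unlift ord0 i is Some j then a 0 j else c).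

Lemma time_mk_point c a : time (mk_point c a) = c.
Proof. by rewrite /time mxE unlift_none. Qed.

Lemma space_mk_point c a : space (mk_point c a) = a.
Proof. by apply/rowP => i; rewrite !mxE liftK. Qed.

(** The unit normal of the totally geodesic hyperplane that is asymptotic to
    [round_sphere a c]; the height it defines is positive near [cap a c]. *)
Definition pole a c := (Num.sqrt (1 - c ^+ 2))^-1 *: mk_point c a.

Lemma pole_radicand_gt0 c : -1 < c < 1 -> 0 < 1 - c ^+ 2.
Proof.
by move=> c1; rewrite subr_gt0 -real_normK ?num_real // expr_lt1 // ltr_norml.
Qed.

Lemma lorentz_pole a c x : lorentz x (pole a c) =
  (dot (space x) a - c * time x) / Num.sqrt (1 - c ^+ 2).
Proof.
by rewrite lorentzZr /lorentz time_mk_point space_mk_point mulrC (mulrC c).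
Qed.

Lemma lorentz_pole_pole a c : dot a a = 1 -> -1 < c < 1 ->
  lorentz (pole a c) (pole a c) = 1.
Proof.
move=> aa /pole_radicand_gt0 c0.
rewrite /pole lorentzZl lorentzZr /lorentz time_mk_point space_mk_point aa.
by rewrite mulrA -invfM -!expr2 sqr_sqrtr ?ltW // mulVf // gt_eqF.
Qed.

End Equidistant.

(** * The Klein compactification *)

Section Compactification.
Variables (R : realType) (n : nat).
Implicit Types (S : set 'rV[R]_n.+2) (a k : 'rV[R]_n.+1) (x : 'rV[R]_n.+2)
  (c s t : R).

Lemma timeZ t x : time (t *: x) = t * time x.
Proof. by rewrite /time mxE. Qed.

Lemma spaceZ t x : space (t *: x) = t *: space x.
Proof. by apply/rowP => i; rewrite !mxE. Qed.

Lemma cvg_row (T : Type) (F : set_system T) {FF : Filter F} (m : nat)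
    (f : T -> 'rV[R]_m) (b : 'rV[R]_m) :
  (forall j, (fun u => f u 0 j) @ F --> b 0 j) -> f @ F --> b.
Proof.
move=> fb; apply/cvgrPdist_le => e e0; near=> u.
rewrite /Num.Def.normr /= mx_normrE (bigmax_le _ (ltW e0)) // => -[i j] _ /=.
rewrite !mxE ord1; move: j; near: u; apply: filter_forall => j.
exact: ((cvgrPdist_le _ _).1 (fb j)).
Unshelve. all: by end_near. Qed.

Definition unklein k : 'rV[R]_n.+2 :=
  (Num.sqrt (1 - dot k k))^-1 *: mk_point 1 k.

Lemma dot_klein x : hyp x -> 1 - dot (klein x) (klein x) = (time x)^-1 ^+ 2.
Proof.
move=> [xx tx]; rewrite /klein dotZl dotZr; move: xx; rewrite /lorentz.
move=> /eqP; rewrite subr_eq => /eqP ->; field.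
by rewrite gt_eqF.
Qed.

Lemma sqrt_klein x : hyp x ->
  Num.sqrt (1 - dot (klein x) (klein x)) = (time x)^-1.
Proof.
move=> hx; rewrite dot_klein // sqrtr_sqr ger0_norm // invr_ge0 ltW //.
by case: hx.
Qed.

Lemma kleinK x : hyp x -> unklein (klein x) = x.
Proof.
move=> hx; rewrite /unklein sqrt_klein // invrK; case: hx => _ tx.
apply: eq_time_space; first by rewrite timeZ time_mk_point mulr1.
by rewrite spaceZ space_mk_point /klein scalerA mulfV ?gt_eqF // scale1r.
Qed.

Lemma hyp_unklein k : dot k k < 1 -> hyp (unklein k).
Proof.
move=> k1; have k0 : 0 < 1 - dot k k by rewrite subr_gt0.
have s0 : 0 < Num.sqrt (1 - dot k k) by rewrite sqrtr_gt0.
split.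
  rewrite /unklein lorentzZl lorentzZr /lorentz time_mk_point space_mk_point.
  rewrite mulrA -invfM -expr2 sqr_sqrtr ?ltW //; field.
  by rewrite gt_eqF.
by rewrite /unklein timeZ time_mk_point mulr1 invr_gt0.
Qed.

Lemma cvg_radius k :
  Num.sqrt (1 - dot l l) @[l --> k] --> Num.sqrt (1 - dot k k).
Proof.
apply: (@cvg_comp _ _ _ (fun l => 1 - dot l l) Num.sqrt (nbhs k)); last first.
  exact: sqrt_continuous.
apply: (@cvgB R R _ (nbhs k) _ (fun=> 1) (fun l => dot l l)).
  exact: cvg_cst.
by apply: cvg_dot; exact: cvg_id.
Qed.

Lemma cvg_pairing a c k : dot l a - c @[l --> k] --> dot k a - c.
Proof.
apply: (@cvgB R R _ (nbhs k) _ (fun l => dot l a) (fun=> c)).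
  by apply: (@cvg_dot _ _ (nbhs k) _ _ id (fun=> a));
    [exact: cvg_id|exact: cvg_cst].
exact: cvg_cst.
Qed.

Lemma cvg_unklein k : dot k k < 1 -> {for k, continuous unklein}.
Proof.
move=> k1.
apply: (@cvgZ _ _ _ (nbhs k) _ (fun k => (Num.sqrt (1 - dot k k))^-1) (mk_point 1)).
  apply: (@cvgV R _ (nbhs k) _ (fun k => Num.sqrt (1 - dot k k))).
    by rewrite gt_eqF // sqrtr_gt0 subr_gt0.
  exact: cvg_radius.
apply: cvg_row => j; have [i ->|->] := unliftP ord0 j; rewrite !mxE.
  by under eq_fun do rewrite mxE liftK; rewrite liftK; apply: cvg_coord; exact: cvg_id.
under eq_fun do rewrite mxE unlift_none; rewrite unlift_none.
exact: cvg_cst.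
Qed.

(** Up to a positive factor the height is the time coordinate multiplied by a function
    that extends continuously to the closed ball, so its sign at infinity tells
    whether it tends to plus or minus infinity. *)
Lemma height_klein a c x : hyp x ->
  dot (space x) a - c * time x = time x * (dot (klein x) a - c).
Proof. by move=> [_ tx]; rewrite /klein dotZl; field; rewrite gt_eqF. Qed.

Lemma closure_sub (T : topologicalType) (A C : set T) :
  closed C -> A `<=` C -> closure A `<=` C.
Proof.
by move=> Cc AC; rewrite [X in _ `<=` X]((closure_id C).1 Cc); exact: closureS.
Qed.

Lemma continuous_height a c s :
  continuous (fun k => dot k a - c - s * Num.sqrt (1 - dot k k)).
Proof.
move=> k; apply: (@cvgB R R _ (nbhs k) _ (fun l => dot l a - c)
  (fun l => s * Num.sqrt (1 - dot l l))); first exact: cvg_pairing.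
apply: (@cvgM R _ (nbhs k) _ (fun=> s) (fun l => Num.sqrt (1 - dot l l))).
  exact: cvg_cst.
exact: cvg_radius.
Qed.

Lemma closed_unit_ball : closed [set k : 'rV[R]_n.+1 | dot k k <= 1].
Proof.
apply: (@preimage_closed _ _ (fun k => dot k k) [set y | y <= 1]).
  by move=> k _; apply: (@cvg_dot _ _ (nbhs k) _ _ id id); exact: cvg_id.
exact: closed_le.
Qed.

Lemma compact_unit_ball : compact [set k : 'rV[R]_n.+1 | dot k k <= 1].
Proof.
apply: bounded_closed_compact; last exact: closed_unit_ball.
exists 1; split=> // M M1 k /= k1; rewrite /Num.Def.normr /= mx_normrE.
apply: bigmax_le; first by rewrite ltW // (lt_trans _ M1).
move=> [i j] _ /=; rewrite ord1; apply: le_trans (ltW M1).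
rewrite -(@expr_le1 _ 2) // real_normK ?num_real //; apply: le_trans k1.
rewrite /dot (bigD1 j) //= -expr2 lerDl.
by apply: sumr_ge0 => l _; rewrite -expr2 sqr_ge0.
Qed.

(** The height of [x] is at least that of a fixed point exactly on a closed condition on
    [klein x], one that still makes sense on the closed ball.  The closure of
    [klein @` S] cut by this condition is compact, and it misses the sphere because the
    boundary of [S] is on the negative side of the hyperplane; so the extreme value
    theorem applies inside the open ball, and the maximum is attained in [S] as [S] is
    closed. *)
Lemma max_height S a c :
  S `<=` @hyp R n -> (forall x, hyp x -> closure S x -> S x) -> S !=set0 ->
  asymp_boundary S `<=` cap (- a) (- c) -> -1 < c < 1 ->
  exists2 p, S p & forall x, S x -> lorentz x (pole a c) <= lorentz p (pole a c).
Proof.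
move=> Sh Sc [x0 Sx0] bS c1.
have c0 : 0 < (Num.sqrt (1 - c ^+ 2))^-1.
  by rewrite invr_gt0 sqrtr_gt0 pole_radicand_gt0.
pose G x := dot (space x) a - c * time x.
suff [p Sp pmax] : exists2 p, S p & forall x, S x -> G x <= G p.
  exists p => // x Sx; rewrite !lorentz_pole ler_pM2r //.
  exact: pmax.
(* the level of an arbitrary point of S serves as the lower bound *)
pose m := G x0.
have above x : S x ->
    (0 <= dot (klein x) a - c - m * Num.sqrt (1 - dot (klein x) (klein x))) =
    (m <= G x).
  move=> /Sh hx; rewrite /G height_klein // sqrt_klein //; case: hx => _ tx.
  by rewrite subr_ge0 ler_pdivrMr // [leRHS]mulrC.
pose K := closure (@klein R n @` S) `&`
  [set k | 0 <= dot k a - c - m * Num.sqrt (1 - dot k k)].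
have clball : closure (@klein R n @` S) `<=` [set k | dot k k <= 1].
  apply: closure_sub; first exact: closed_unit_ball.
  move=> _ [x /Sh hx <-] /=; rewrite -subr_ge0 dot_klein //; exact: sqr_ge0.
have Kc : compact K.
  apply: (@subclosed_compact _ _ [set k : 'rV[R]_n.+1 | dot k k <= 1]).
  - apply: closedI; first exact: closed_closure.
    apply: (@preimage_closed _ _
      (fun k => dot k a - c - m * Num.sqrt (1 - dot k k)) [set y | 0 <= y]).
      by move=> k _; exact: continuous_height.
    exact: closed_ge.
  - exact: compact_unit_ball.
  - by move=> k [/clball].
have K1 k : K k -> dot k k < 1.
  move=> [ck /= hk]; rewrite lt_neqAle clball // andbT; apply/negP => /eqP kk.
  have [_] := bS k (conj kk ck).
  rewrite dotNr ltrN2; move: hk; rewrite kk subrr sqrtr0 mulr0 subr0 subr_ge0.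
  by move=> h1 /(le_lt_trans h1); rewrite ltxx.
pose phi k := (dot k a - c) / Num.sqrt (1 - dot k k).
have phi_klein x : S x -> phi (klein x) = G x.
  move=> /Sh hx; rewrite /phi /G height_klein // sqrt_klein // invrK.
  by rewrite mulrC.
have K0 : K !=set0.
  exists (klein x0); split; last by rewrite /= above.
  by apply: subset_closure; exists x0.
have phic : {within K, continuous phi}.
  apply: continuous_in_subspaceT => k; rewrite inE => /K1 k1.
  apply: (@cvgM R _ (nbhs k) _ (fun l => dot l a - c)
    (fun l => (Num.sqrt (1 - dot l l))^-1)); first exact: cvg_pairing.
  apply: (@cvgV R _ (nbhs k) _ (fun l => Num.sqrt (1 - dot l l))).
    by rewrite gt_eqF // sqrtr_gt0 subr_gt0.
  exact: cvg_radius.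
have [k0] := EVT_max_rV K0 Kc phic; rewrite inE => Kk0 k0max.
have k01 := K1 _ Kk0.
have hp := hyp_unklein k01.
have Sp : S (unklein k0).
  apply: Sc => // V Vp.
  have [_ [[x Sx <-] Vx]] := Kk0.1 _ (cvg_unklein k01 Vp).
  by exists x; split=> //; move: Vx; rewrite /= kleinK //; exact: Sh.
have Gp : G (unklein k0) = phi k0.
  rewrite /phi /G /unklein timeZ spaceZ time_mk_point space_mk_point dotZl.
  by field; rewrite gt_eqF // sqrtr_gt0 subr_gt0.
exists (unklein k0) => // x Sx; rewrite Gp.
have [xm|xm] := leP m (G x).
  rewrite -phi_klein //; apply: k0max; rewrite inE; split.
    by apply: subset_closure; exists x.
  by rewrite /= above.
apply: (le_trans (ltW xm)); rewrite /m -phi_klein //; apply: k0max; rewrite inE.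
split; last by rewrite /= above.
by apply: subset_closure; exists x0.
Qed.

(** Near an ideal point of the open cap [cap a c] the height is unbounded; the centre
    [a] of the cap is a convenient one. *)
Lemma high_point (D : set 'rV[R]_n.+2) a c s :
  D `<=` @hyp R n -> dot a a = 1 -> -1 < c < 1 ->
  asymp_boundary D a -> exists2 x, D x & s < lorentz x (pole a c).
Proof.
move=> Dh aa c1 [_ cla].
have c0 : 0 < Num.sqrt (1 - c ^+ 2) by rewrite sqrtr_gt0 pole_radicand_gt0.
pose s' := s * Num.sqrt (1 - c ^+ 2).
have : \forall k \near a, 0 < dot k a - c - s' * Num.sqrt (1 - dot k k).
  have := @continuous_height a c s' a.
  rewrite /continuous_at aa subrr sqrtr0 mulr0 subr0 => /cvgr_gt; apply.
  by rewrite subr_gt0; case/andP: c1.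
move=> /cla[_ [[x Dx <-] hx]]; exists x => //; have [_ tx] := Dh x Dx.
rewrite lorentz_pole ltr_pdivlMr // -/s' height_klein; last exact: Dh.
move: hx; rewrite sqrt_klein; last exact: Dh.
by rewrite subr_gt0 ltr_pdivrMr // mulrC.
Qed.

End Compactification.

(** * Reversing the orientation *)

Section Reversal.
Variables (R : realType) (n : nat).

(** Substitute [- 'X] for the variable. *)
Lemma char_poly_opp (m : nat) (A : 'M[R]_m) (k : 'I_m -> R) :
  char_poly A = \prod_i ('X - (k i)%:P) ->
  char_poly (- A) = \prod_i ('X - (- k i)%:P).
Proof.
move=> E.
have EX (b : R) : comp_poly (- 'X) ('X - b%:P) = - ('X - (- b)%:P).
  by rewrite comp_polyB comp_polyX comp_polyC polyCN opprK opprD.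
have -> : char_poly (- A) = (-1) ^+ m * comp_poly (- 'X) (char_poly A).
  rewrite /char_poly -det_map_mx -detZ; congr (\det _).
  apply/matrixP => i j; rewrite !mxE rmorphB rmorphMn /= comp_polyX comp_polyC.
  by rewrite polyCN opprK mulN1r mulNrn opprB opprK addrC.
rewrite E rmorph_prod /=; under eq_bigr do rewrite EX.
rewrite prodrN card_ord mulrA -exprD addnn -mul2n exprM sqrrN expr1n expr1n.
by rewrite mul1r.
Qed.

Lemma mean_curvature_at_opp (S Dp Dm : set 'rV[R]_n.+2) (p : 'rV[R]_n.+2)
    (h : R) :
  mean_curvature_at S Dp Dm p h -> mean_curvature_at S Dm Dp p (- h).
Proof.
move=> [U [f [q [N [k [lp [NN Np Nf] pts pc hE]]]]]].
exists U, f, q, (- N), (fun i => - k i); split=> //.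
- by split; rewrite ?lorentzNl ?lorentzNr ?NN ?Np ?opprK ?oppr0 // => i;
    rewrite lorentzNl Nf oppr0.
- have E t : geodesic p (- N) t = geodesic p N (- t).
    by rewrite /geodesic opprK [expR (- t) + _]addrC scalerN -scaleNr -mulNr opprB.
  by apply: filterS pts => t [? ?]; rewrite !E opprK.
- rewrite /principal_curvatures.
  have -> : shape_operator f q (- N) = - shape_operator f q N.
    rewrite /shape_operator -mulmxN; congr (_ *m _).
    by apply/matrixP => i j; rewrite !mxE lorentzNr.
  exact: char_poly_opp.
- by rewrite sumrN mulNr hE.
Qed.

(** Reversing the orientation exchanges the two sides and changes the sign of the mean
    curvature, so every one-sided estimate yields its mirror image. *)
Lemma complete_cmc_opp (H : R) (G Op Om : set 'rV[R]_n.+1)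
    (S Dp Dm : set 'rV[R]_n.+2) :
  complete_cmc_hypersurface H G Op Om S Dp Dm ->
  complete_cmc_hypersurface (- H) G Om Op S Dm Dp.
Proof.
move=> [cS bS [[oDp oDm] DD DU bp bm] mc]; split=> //.
  by split=> //; [rewrite setIC|rewrite setUC].
by move=> p /mc; exact: mean_curvature_at_opp.
Qed.

Lemma pole_opp (a : 'rV[R]_n.+1) (c : R) : pole (- a) (- c) = - pole a c.
Proof.
rewrite /pole sqrrN -[RHS]scalerN; congr (_ *: _).
by apply/rowP => i; rewrite !mxE; case: unlift => [j|]; rewrite ?mxE.
Qed.

End Reversal.

(** * The barrier argument *)

Section Barrier.
Variables (R : realType) (n : nat).
Implicit Types (S Dp Dm : set 'rV[R]_n.+2) (G Op Om : set 'rV[R]_n.+1)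
  (a : 'rV[R]_n.+1) (c s H : R).

(** The height at which the equidistant hypersurface has mean curvature [H], the solution
    [s] of [s + H sqrt (1 + s^2) = 0]. *)
Definition critical_height H := - H / Num.sqrt (1 - H ^+ 2).

Lemma critical_height_opp H : critical_height (- H) = - critical_height H.
Proof. by rewrite /critical_height sqrrN mulNr. Qed.

Lemma le_critical_height H s : -1 < H < 1 ->
  s + H * Num.sqrt (1 + s ^+ 2) <= 0 -> s <= critical_height H.
Proof.
move=> H1; have H0 := pole_radicand_gt0 H1.
rewrite /critical_height ler_pdivlMr ?sqrtr_gt0 //.
set e := Num.sqrt (1 - H ^+ 2); set w := Num.sqrt _ => sHw.
have e2 : e ^+ 2 = 1 - H ^+ 2 by rewrite sqr_sqrtr // ltW.
have w2 : w ^+ 2 = 1 + s ^+ 2 by rewrite sqr_sqrtr // addr_ge0 ?sqr_ge0.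
have e0 : 0 <= e by exact: sqrtr_ge0.
have w0 : 0 <= w by exact: sqrtr_ge0.
have key : (s * e) ^+ 2 - H ^+ 2 = s ^+ 2 - (H * w) ^+ 2.
  by rewrite !exprMn e2 w2; ring.
have [s0|s0] := leP 0 s.
  have Hw : s <= - (H * w) by lra.
  have HN : 0 <= - H.
    rewrite leNgt; apply/negP => HN; have HP : 0 < H by lra.
    have : 0 <= H * w by rewrite mulr_ge0 // ltW.
    have w1 : 0 < w by rewrite sqrtr_gt0 ltr_wpDr ?sqr_ge0.
    by have := mulr_gt0 HP w1; lra.
  rewrite -(@ler_pXn2r _ 2) ?nnegrE ?mulr_ge0 // sqrrN -subr_le0 key subr_le0.
  by rewrite -[leRHS]sqrrN ler_pXn2r ?nnegrE // (le_trans s0).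
have [HN|HP] := leP H 0.
  by apply: (@le_trans _ _ 0); rewrite ?oppr_ge0 // mulr_le0_ge0 // ltW.
have {}s0 : 0 <= - s by lra.
have {}HP : 0 <= H by exact: ltW.
rewrite lerNr -mulNr -(@ler_pXn2r _ 2) ?nnegrE ?mulr_ge0 //.
rewrite mulNr sqrrN -subr_ge0 key subr_ge0 -[leRHS]sqrrN.
by rewrite ler_pXn2r ?nnegrE ?mulr_ge0 //; lra.
Qed.

(** The region above height [s] contains no point of [S], is connected, and contains points of
    [Dp] close to [a]. *)
Lemma region_in_side S Dp Dm a c s :
  rel_open (@hyp R n) Dp -> rel_open (@hyp R n) Dm -> Dp `&` Dm = set0 ->
  Dp `|` Dm = @hyp R n `\` S -> dot a a = 1 -> -1 < c < 1 ->
  asymp_boundary Dp a ->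
  (forall x, S x -> lorentz x (pole a c) <= s) ->
  forall x, hyp x -> s < lorentz x (pole a c) -> Dp x.
Proof.
move=> oDp oDm DD DU aa c1 ba Sle x hx sx.
have Dph : Dp `<=` @hyp R n by case: oDp => W _ -> y [].
have [y Dy sy] := high_point s Dph aa c1 ba.
apply: (@upper_region_relopen _ _ Dp Dm (pole a c) s y x) => //.
- exact: lorentz_pole_pole.
- move=> z hz sz; rewrite DU; split=> // /Sle.
  by rewrite leNgt sz.
- exact: Dph.
Qed.

(** A hypersurface of constant mean curvature [H] whose boundary lies below the hyperplane
    cannot rise above the equidistant hypersurface of the same curvature: the
    mean curvature at its highest point would have to be smaller than [H]. *)
Lemma cmc_barrier H G Op Om S Dp Dm a c : (0 < n)%N -> -1 < H < 1 ->
  complete_cmc_hypersurface H G Op Om S Dp Dm ->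
  dot a a = 1 -> -1 < c < 1 -> cap a c `<=` Op -> G `<=` cap (- a) (- c) ->
  forall x, S x -> lorentz x (pole a c) <= critical_height H.
Proof.
move=> n0 H1 [[[Sh _] _] bS [[oDp oDm] DD DU [bp _] _] mc] aa c1 capO GT x Sx.
have Sc y : hyp y -> closure S y -> S y.
  move=> hy cSy; apply: contrapT => nSy.
  have : (Dp `|` Dm) y by rewrite DU.
  have off D : rel_open (@hyp R n) D -> D `<=` Dp `|` Dm -> ~ D y.
    move=> [W Wo DE] DDU; rewrite DE => -[_ Wy].
    have [z [Sz Wz]] := cSy _ (open_nbhs_nbhs (conj Wo Wy)).
    have : D z by rewrite DE; split=> //; exact: Sh.
    by move=> /DDU; rewrite DU => -[].
  by case; [apply: (off Dp) => // z ?; left|apply: (off Dm) => // z ?; right].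
have [p Sp pmax] : exists2 p, S p &
    forall y, S y -> lorentz y (pole a c) <= lorentz p (pole a c).
  by apply: max_height => //; [exists x|rewrite bS].
apply: (le_trans (pmax x Sx)); apply: le_critical_height => //.
have Dmh : Dm `<=` @hyp R n by case: oDm => W _ -> y [].
apply: (touching_height n0 Sh Dmh DD _ Sp pmax _ (mc p Sp)).
  exact: lorentz_pole_pole.
apply: (region_in_side oDp oDm DD DU aa c1 _ pmax).
by apply: bp; apply: capO; split; rewrite ?aa //; case/andP: c1.
Qed.

(** The boundary of [S] is [round_sphere a c] itself, so [cmc_barrier] does not apply to
    the hyperplane of [a] and [c]; it applies, with reversed orientation, to those of
    [a] and [c'] for all [c'] below [c], and the estimates pass to the limit. *)
Lemma round_sphere_barrier H S Dp Dm a c : (0 < n)%N -> -1 < H < 1 ->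
  dot a a = 1 -> -1 < c < 1 ->
  complete_cmc_hypersurface H (round_sphere a c) (cap a c) (cap (- a) (- c))
    S Dp Dm ->
  forall x, S x -> critical_height H <= lorentz x (pole a c).
Proof.
move=> n0 H1 aa c1 cmc x Sx.
have aa' : dot (- a) (- a) = 1 by rewrite -scaleN1r dotZl dotZr aa; ring.
have H1' : -1 < - H < 1 by move: H1; lra.
(* the boundary of S lies strictly above each of these hyperplanes *)
have below c' : -1 < c' < c -> critical_height H <= lorentz x (pole a c').
  move=> c'1; have c'1' : -1 < - c' < 1 by move: c'1 c1; lra.
  have := @cmc_barrier _ _ _ _ _ _ _ (- a) (- c') n0 H1' (complete_cmc_opp cmc)
    aa' c'1' _ _ _ Sx.
  rewrite pole_opp critical_height_opp lorentzNr lerN2; apply.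
    move=> xi [sxi h]; split=> //; apply: lt_trans h.
    by rewrite ltrN2; case/andP: c'1.
  move=> xi [sxi h]; split=> //; rewrite !opprK h; by case/andP: c'1.
have lim : lorentz x (pole a c') @[c' --> c^'-] --> lorentz x (pole a c).
  rewrite lorentz_pole; under eq_fun do rewrite lorentz_pole.
  have cc : (fun c' : R => c') @ c^'- --> c by apply: cvg_at_left_filter; exact: cvg_id.
  apply: (@cvgM R _ (c^'-) _ (fun c' => dot (space x) a - c' * time x)
    (fun c' => (Num.sqrt (1 - c' ^+ 2))^-1)).
    apply: (@cvgB R R _ (c^'-) _ (fun=> dot (space x) a) (fun c' => c' * time x)).
      exact: cvg_cst.
    by apply: cvgM => //; exact: cvg_cst.
  apply: (@cvgV R _ (c^'-) _ (fun c' => Num.sqrt (1 - c' ^+ 2))).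
    by rewrite gt_eqF // sqrtr_gt0 pole_radicand_gt0.
  apply: (@cvg_comp _ _ _ (fun c' => 1 - c' ^+ 2) Num.sqrt (c^'-)); last first.
    exact: sqrt_continuous.
  apply: (@cvgB R R _ (c^'-) _ (fun=> 1) (fun c' => c' ^+ 2)).
    exact: cvg_cst.
  by rewrite expr2; apply: cvgM.
have nbelow : \forall c' \near c^'-, critical_height H <= lorentz x (pole a c').
  near=> c'; apply: below; apply/andP; split; near: c'.
    by apply: nbhs_left_gt; case/andP: c1.
  exact: nbhs_left_lt.
have cl : closed [set y : R | critical_height H <= y] by exact: closed_ge.
exact: (closed_cvg _ cl nbelow _ lim).
Unshelve. all: by end_near. Qed.

Lemma half_space_barrier H G Op Om S Dp Dm a c PH DpH DmH D :
  (0 < n)%N -> -1 < H < 1 -> G !=set0 ->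
  complete_cmc_hypersurface H G Op Om S Dp Dm ->
  dot a a = 1 -> -1 < c < 1 ->
  complete_cmc_hypersurface H (round_sphere a c) (cap a c) (cap (- a) (- c))
    PH DpH DmH ->
  cap a c `<=` Op -> G `<=` cap (- a) (- c) ->
  D = DpH \/ D = DmH -> G `<=` asymp_boundary D ->
  S `<=` closure D.
Proof.
move=> n0 H1 [xi Gxi] cmcS aa c1 cmcP capO GT DE bG x Sx.
have xS := cmc_barrier n0 H1 cmcS aa c1 capO GT Sx.
have PHle y : PH y -> lorentz y (pole (- a) (- c)) <= - critical_height H.
  by move=> /(round_sphere_barrier n0 H1 aa c1 cmcP); rewrite pole_opp lorentzNr lerN2.
have [_ _ [[oDp oDm] DD DU [_ bp] [bm _]] _] := cmcP.
(* the boundary of the positive side is in the closed cap, away from G *)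
have {DE bG} -> : D = DmH.
  case: DE => // DE; have := bG xi Gxi; rewrite DE => /bp.
  have [_] := GT xi Gxi; rewrite dotNr ltrN2 => xic.
  by case=> -[_]; [move=> h; have := lt_trans xic h; rewrite ltxx
    |move=> h; move: xic; rewrite h ltxx].
have aa' : dot (- a) (- a) = 1 by rewrite -scaleN1r dotZl dotZr aa; ring.
have c1' : -1 < - c < 1 by move: c1; lra.
have below : [set y | hyp y /\ - critical_height H < lorentz y (pole (- a) (- c))]
    `<=` DmH.
  move=> y [hy hlt].
  apply: (@region_in_side PH DmH DpH (- a) (- c) (- critical_height H)) => //.
  - by rewrite setIC.
  - by rewrite setUC.
  - by apply: bm; split; rewrite ?aa' //; case/andP: c1'.
apply: (closureS below); apply: closure_upper_region.
- exact: lorentz_pole_pole.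
- by case: cmcS => [[[Sh _] _] _ _ _]; exact: Sh.
- by rewrite pole_opp lorentzNr lerN2.
Qed.

End Barrier.

Theorem theorem3p2 (R : realType) (n : nat) (hn : (2 <= n)%N)
    (H : R) (hH : -1 < H < 1)
    (Gamma Omega_p Omega_m : set 'rV[R]_n.+1)
    (hGamma : closed_codim1_submanifold Gamma)
    (hOmega : separates_sphere Gamma Omega_p Omega_m)
    (Sigma D_p D_m : set 'rV[R]_n.+2)
    (hSigma : complete_cmc_hypersurface H Gamma Omega_p Omega_m Sigma D_p D_m) :
  Sigma `<=` shifted_convex_hull H Gamma Omega_p Omega_m.
Proof.
have n0 : (0 < n)%N by exact: ltn_trans hn.
(* the sphere at infinity is connected, so an empty set does not separate it *)
have G0 : Gamma !=set0.
  apply: contrapT => /set0P/negP; rewrite negbK => /eqP G0.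
  case: hOmega => oOp oOm [Op0 Om0] OO OU.
  by apply: (sphere_connected n0 oOp oOm OO _ Op0 Om0); rewrite OU G0 setD0.
move=> x Sx; split; first by case: hSigma => [[[Sh _] _] _ _ _]; exact: Sh.
move=> D [a [c [PH [Dp [Dm /= [[aa c1] compat cmcP DE bG]]]]]].
case: compat => [[_ capO GT]|[_ capO GT]].
  exact: (half_space_barrier n0 hH G0 hSigma aa c1 cmcP capO GT DE bG).
have aa' : dot (- a) (- a) = 1 by rewrite -scaleN1r dotZl dotZr aa; ring.
have c1' : -1 < - c < 1 by move: c1; lra.
have hH' : -1 < - H < 1 by move: hH; lra.
have cmcP' := complete_cmc_opp cmcP.
have TE : round_sphere a c = round_sphere (- a) (- c).
  apply/seteqP; split=> xi [sxi E]; split=> //; first by rewrite dotNr E.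
  by apply: oppr_inj; rewrite -dotNr.
have CE : cap a c = cap (- - a) (- - c) by rewrite !opprK.
rewrite TE CE in cmcP'; rewrite CE in GT.
apply: (half_space_barrier n0 hH' G0 (complete_cmc_opp hSigma) aa' c1' cmcP'
  capO GT _ bG Sx).
by case: DE; [right|left].
Qed.
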